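(* Let $S_{m,n}$ be sparse sign embeddings with sparsity $\zeta_m$, and let $(a_n)_{n\ge1}$, $(\tilde a_n)_{n\ge1}$ be sequences of deterministic unit vectors $a_n,\tilde a_n\in\mathbb R^n$. If, as $m,n\to\infty$, $\zeta_m^2/m\to0$, $$\frac{\sqrt m}{\zeta_m}\sum_{i=1}^na_{n,i}^4\to0\quad\text{and}\quad\frac{\sqrt m}{\zeta_m}\sum_{i=1}^n\tilde a_{n,i}^4\to0,$$ then $$\sqrt{\frac m{1+(a_n^\top\tilde a_n)^2}}\;\big(a_n^\top S_{m,n}^\top S_{m,n}\tilde a_n-a_n^\top\tilde a_n\big)\Rightarrow\mathcal N(0,1).$$
   Context: Asymptotic regime: $n\to\infty$, $m=m_n\to\infty$, $m<n$. A sparse sign embedding with integer sparsity $1\le\zeta_m\le m$ is the random $m\times n$ matrix $S_{m,n}=(R_{m,1},\dots,R_{m,n})$ whose columns are i.i.d. uniform on $\{f/\sqrt{\zeta_m}:f\in\{-1,0,1\}^m,\ \|f\|^2=\zeta_m\}$ ($\zeta_m=1$ is CountSketch). *)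

(* Defs.v *)
From HB Require Import structures.
From mathcomp Require Import all_boot all_order all_algebra finmap.
From mathcomp Require Import all_classical all_reals all_analysis.
Import Order.TTheory GRing.Theory Num.Theory.
Import numFieldNormedType.Exports.

Set Implicit Arguments.
Unset Strict Implicit.
Unset Printing Implicit Defensive.

Local Open Scope classical_set_scope.
Local Open Scope ring_scope.

(* Euclidean inner product. The norm [`|_|] that the library puts on matrices is
   the sup norm, so the squared Euclidean norm of [u] is written [dotp u u]. *)
Definition dotp (R : realType) (n : nat) (u v : 'cV[R]_n) : R :=
  (u^T *m v) 0 0.

Definition borel (V : topologicalType) : set (set V) := <<s @open V >>.

Definition random_element d (T : measurableType d) (V : topologicalType)
    (X : T -> V) : Prop :=
  forall B, borel B -> measurable (X @^-1` B).

(* The law of [X] is the normalized counting measure on the finite set [A];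
   taking [B = setT] forces [A] to be nonempty. *)
Definition uniform_on (R : realType) d (T : measurableType d)
    (P : probability T R) (V : topologicalType) (X : T -> V) (A : set V) : Prop :=
  finite_set A /\
  forall B, borel B ->
    P (X @^-1` B) =
    ((#|` fset_set (A `&` B)|)%:R / (#|` fset_set A|)%:R)%:E.

(* Mutual independence of a finite family: the product rule for subfamilies is
   the case where some of the [B i] are [setT]. *)
Definition independent_family (R : realType) d (T : measurableType d)
    (P : probability T R) (V : topologicalType) (n : nat)
    (X : 'I_n -> T -> V) : Prop :=
  forall B : 'I_n -> set V, (forall i, borel (B i)) ->
    P (\bigcap_(i in [set: 'I_n]) (X i @^-1` B i)) =
    (\prod_(i < n) P (X i @^-1` B i))%E.

(* { f / sqrt k : f \in {-1, 0, 1}^m, ||f||^2 = k } *)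
Definition sparse_sign_vectors (R : realType) (m k : nat) : set 'cV[R]_m :=
  [set (Num.sqrt k%:R)^-1 *: f | f in
    [set f : 'cV[R]_m | (forall i, f i 0 \in [:: -1; 0; 1]) /\
                        dotp f f = k%:R]].

Definition sparse_sign_embedding (R : realType) d (T : measurableType d)
    (P : probability T R) (m n k : nat) (S : T -> 'M[R]_(m, n)) : Prop :=
  [/\ forall j : 'I_n, random_element (fun w => col j (S w)),
      independent_family P (fun (j : 'I_n) w => col j (S w)) &
      forall j : 'I_n,
        uniform_on P (fun w => col j (S w)) (@sparse_sign_vectors R m k)].

(* Convergence in distribution of real random variables, possibly living on
   different probability spaces: convergence of the distribution functions at
   every continuity point of the limiting one. *)
Definition cvg_in_distribution (R : realType) (d : nat -> measure_display)
    (T : forall n, measurableType (d n)) (P : forall n, probability (T n) R)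
    (X : forall n, T n -> R) (mu : set R -> \bar R) : Prop :=
  forall x : R, {for x, continuous (fun y : R => mu `]-oo, y]%classic)} ->
    P n [set w | X n w <= x] @[n --> \oo] --> mu `]-oo, x]%classic.

(* Main.v *)
Require Import Defs.
From HB Require Import structures.
From mathcomp Require Import all_boot all_order all_algebra finmap.
From mathcomp Require Import all_classical all_reals all_analysis.
From mathcomp Require Import perm measurable_realfun ring lra.
Import Order.TTheory GRing.Theory Num.Theory.
Import numFieldNormedType.Exports.

(** Let R_1, ..., R_n be the columns of S. They are unit vectors, so the centred
and normalized form is
[X = 1/2 sum_(j <> k) c_jk <R_j, R_k>] with [c_jk = s (a_j a'_k + a_k a'_j)].
Let [D_k = sum_j c_jk <R_j, R_k>] be the part of X that involves column k. The
law of R_k is symmetric, so D_k has mean zero given the other columns, while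
X - D_k does not depend on column k. This is the setting of Stein's method:
[E[X f(X)] = 1/2 sum_k E[D_k (f(X) - f(X - D_k))]], and a Taylor expansion turns
the right-hand side into [E[T f'(X)]], where [T = 1/2 sum_k |sum_j c_jk R_j|^2 / m]
collects the conditional variances of the D_k. The error is governed by
[sum_k E D_k^4]. Because the R_j are unit vectors, T is a constant close to 1 plus
a quadratic form of the same kind as X, whose variance is of order 1/m. This is
[stein_bound_quad].

The fourth moments come from the sign symmetries of the columns
([avg_pow4_sign_symmetric], [avg_incr4], [isotropic_entry]). Up to constants
[sum_k E D_k^4] is at most [m/zeta^2 A A' + A + A'], where A and A' are the sums of
the fourth powers of the entries of a and a'. The first term is the product of the
two delocalization quantities, and zeta^2/m -> 0 makes A and A' smaller than these
quantities ([stein_bound_embedding]).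

To pass from [E[f'(X) - X f(X)] -> 0] to distribution functions, only Lipschitz
functions h of compact support and Gaussian mean zero are needed. For these the
solution f of [f' - x f = h] has compact support too, so its regularity is
immediate ([stein_equation]). An indicator is compared with a multiple of a
plateau of total Gaussian mass nearly 1, and the bounded second moment of X
controls what is left ([stein_criterion]).

Each column takes finitely many values, so the law of S is the counting measure on
a finite set of configurations ([probability_embedding]), and all expectations of
functions of S are finite averages. *)

Set Implicit Arguments.
Unset Strict Implicit.
Unset Printing Implicit Defensive.

Local Open Scope classical_set_scope.
Local Open Scope ring_scope.

(** * Averages and a fourth moment inequality *)

Definition avg (R : realType) (I : finType) (F : I -> R) : R :=
  (\sum_i F i) / #|I|%:R.

Section Averages.
Context {R : realType} {I : finType}.
Implicit Types F G : I -> R.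

Lemma eq_avg F G : F =1 G -> avg F = avg G.
Proof. by move=> FG; rewrite /avg (eq_bigr G). Qed.

Lemma avgD F G : avg (fun w => F w + G w) = avg F + avg G.
Proof. by rewrite /avg big_split mulrDl. Qed.

Lemma avgZ (c : R) F : avg (fun w => c * F w) = c * avg F.
Proof. by rewrite /avg -mulr_sumr mulrA. Qed.

Lemma avgB F G : avg (fun w => F w - G w) = avg F - avg G.
Proof. by rewrite /avg sumrB mulrBl. Qed.

Lemma avg_sum (J : finType) (F : J -> I -> R) :
  avg (fun w => \sum_j F j w) = \sum_j avg (F j).
Proof. by rewrite /avg exchange_big /= mulr_suml. Qed.

Lemma avg_sum_seq (J : eqType) (r : seq J) (F : J -> I -> R) :
  avg (fun w => \sum_(j <- r) F j w) = \sum_(j <- r) avg (F j).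
Proof. by rewrite /avg exchange_big /= mulr_suml. Qed.

Lemma le_avg F G : (forall w, F w <= G w) -> avg F <= avg G.
Proof. by move=> FG; rewrite ler_wpM2r ?invr_ge0// ler_sum. Qed.

Lemma avg_ge0 F : (forall w, 0 <= F w) -> 0 <= avg F.
Proof. by move=> F0; rewrite mulr_ge0 ?invr_ge0// sumr_ge0. Qed.

Lemma avg_cst (c : R) : (0 < #|I|)%N -> avg (fun _ : I => c) = c.
Proof.
move=> I0; rewrite /avg sumr_const -[c *+ _]mulr_natr -mulrA divff ?mulr1//.
by rewrite pnatr_eq0 -lt0n.
Qed.

Lemma ler_norm_avg F : `|avg F| <= avg (fun w => `|F w|).
Proof.
rewrite /avg normrM (@ger0_norm _ #|I|%:R^-1) ?invr_ge0//.
by rewrite ler_wpM2r ?invr_ge0// ler_norm_sum.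
Qed.

Lemma avg_reindex (h : I -> I) F : injective h -> avg (F \o h) = avg F.
Proof. by move=> hI; rewrite /avg [in RHS](reindex_inj hI). Qed.

Lemma avg_odd (h : I -> I) F : injective h -> (forall w, F (h w) = - F w) ->
  avg F = 0.
Proof.
move=> hI Fh; have : avg F = - avg F.
  rewrite -{1}(avg_reindex F hI) -mulN1r -avgZ; apply: eq_avg => w /=.
  by rewrite Fh mulN1r.
by lra.
Qed.

End Averages.

Section SignSymmetry.
Context {R : realType} {I J : finType}.
Variable x : J -> I -> R.

(** Symmetry and independence of the signs of the [x j], in the form in which they are
used: a bijection of the space negates [x i] and preserves all the others. *)
Definition sign_symmetric : Prop := exists phi : J -> I -> I,
  forall i, [/\ injective (phi i), forall w, x i (phi i w) = - x i w &
             forall j w, j != i -> x j (phi i w) = x j w].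

(** Khintchine's inequality for fourth moments, by induction on the number of terms.
When a term y is added to a partial sum T, the averages of T^3 y and T y^3 vanish,
and T^2 can be replaced by its sum of squares Q when it is weighted by y^2. The
new cross term is then 6 y^2 Q, which is what 3 (Q + y^2)^2 provides. *)
Lemma avg_pow4_sign_symmetric : sign_symmetric ->
  avg (fun w => (\sum_j x j w) ^+ 4) <=
    3 * avg (fun w => (\sum_j x j w ^+ 2) ^+ 2).
Proof.
move=> [phi phiP].
have inv (r : seq J) i w : i \notin r -> forall k,
    \sum_(j <- r) x j (phi i w) ^+ k = \sum_(j <- r) x j w ^+ k.
  move=> ir k; rewrite big_seq [RHS]big_seq; apply: eq_bigr => j jr.
  have [_ _ ->//] := phiP i.
  by apply: contraNneq ir => <-.
have inv1 (r : seq J) i w : i \notin r ->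
    \sum_(j <- r) x j (phi i w) = \sum_(j <- r) x j w.
  by move=> /(inv _ _ w) /(_ 1).
suff gen (r : seq J) : uniq r -> avg (fun w => (\sum_(j <- r) x j w) ^+ 4) <=
    3 * avg (fun w => (\sum_(j <- r) x j w ^+ 2) ^+ 2).
  by apply: gen; rewrite /index_enum; case: index_enum_key; rewrite -enumT enum_uniq.
elim: r => [_|i r IH /= /andP[ir ur]].
  under eq_avg do rewrite big_nil expr0n /=.
  under [X in _ <= _ * X]eq_avg do rewrite big_nil expr0n /=.
  by rewrite /avg sumr_const mul0rn mul0r mulr0.
set T := fun w => \sum_(j <- r) x j w; set Q := fun w => \sum_(j <- r) x j w ^+ 2.
have [phiI phio phie] := phiP i.
have o3 : avg (fun w => T w ^+ 3 * x i w) = 0.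
  by apply: (avg_odd phiI) => w; rewrite phio /T inv1// mulrN.
have o1 : avg (fun w => T w * x i w ^+ 3) = 0.
  apply: (avg_odd phiI) => w; rewrite phio /T inv1// .
  by rewrite exprNn -signr_odd /= expr1 mulN1r mulrN.
(* The cross terms of T^2 are odd under a flip of one of their factors. *)
have e2 : avg (fun w => x i w ^+ 2 * T w ^+ 2) = avg (fun w => x i w ^+ 2 * Q w).
  under eq_avg => w do rewrite /T [(\sum_(j <- r) _) ^+ 2]expr2 mulr_suml mulr_sumr.
  under [RHS]eq_avg => w do rewrite /Q mulr_sumr.
  rewrite !avg_sum_seq big_seq [RHS]big_seq; apply: eq_bigr => j jr.
  under eq_avg => w do rewrite mulr_sumr mulr_sumr.
  rewrite avg_sum_seq (bigD1_seq j)//= big1_seq ?addr0.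
    by apply: eq_avg => w; rewrite expr2.
  move=> l /andP[lj lr]; have [phiIl phiol phiel] := phiP l.
  have il : i != l by apply: contraNneq ir => ->.
  have jl : j != l by rewrite eq_sym.
  by apply: (avg_odd phiIl) => w; rewrite phiol (phiel i)// (phiel j)//; ring.
have E1 : avg (fun w => (\sum_(j <- i :: r) x j w) ^+ 4) =
    avg (fun w => T w ^+ 4) + 6 * avg (fun w => x i w ^+ 2 * Q w) +
    avg (fun w => x i w ^+ 4).
  transitivity (avg (fun w => T w ^+ 4 + 4 * (T w ^+ 3 * x i w) +
      6 * (x i w ^+ 2 * T w ^+ 2) + 4 * (T w * x i w ^+ 3) + x i w ^+ 4)).
    by apply: eq_avg => w; rewrite big_cons /= -/(T w); ring.
  by rewrite !avgD !avgZ o3 o1 e2; ring.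
have E2 : avg (fun w => (\sum_(j <- i :: r) x j w ^+ 2) ^+ 2) =
    avg (fun w => Q w ^+ 2) + 2 * avg (fun w => x i w ^+ 2 * Q w) +
    avg (fun w => x i w ^+ 4).
  transitivity (avg (fun w => Q w ^+ 2 + 2 * (x i w ^+ 2 * Q w) + x i w ^+ 4)).
    by apply: eq_avg => w; rewrite big_cons /= -/(Q w); ring.
  by rewrite !avgD !avgZ.
rewrite E1 E2.
have p4 : 0 <= avg (fun w => x i w ^+ 4).
  by apply: avg_ge0 => w; rewrite exprn_even_ge0.
have := IH ur; rewrite -/T -/Q; lra.
Qed.

End SignSymmetry.

(** * Quadratic forms in independent isotropic columns *)

Definition dot (R : realType) (m : nat) (x y : 'I_m -> R) : R :=
  \sum_r x r * y r.

Lemma dotC (R : realType) (m : nat) (x y : 'I_m -> R) : dot x y = dot y x.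
Proof. by apply: eq_bigr => r _; rewrite mulrC. Qed.

Lemma dot_ge0 (R : realType) (m : nat) (x : 'I_m -> R) : 0 <= dot x x.
Proof. by apply: sumr_ge0 => r _; rewrite -expr2 sqr_ge0. Qed.

Lemma dot_sumr (R : realType) (m : nat) (J : finType) (b : J -> R)
    (y : J -> 'I_m -> R) (x : 'I_m -> R) :
  dot x (fun r => \sum_j b j * y j r) = \sum_j b j * dot x (y j).
Proof.
rewrite /dot; under eq_bigr do rewrite mulr_sumr.
rewrite exchange_big /=; apply: eq_bigr => j _.
by rewrite mulr_sumr; apply: eq_bigr => r _; rewrite mulrCA.
Qed.

Lemma sqr_sum (R : realType) (J : finType) (F : J -> R) :
  (\sum_j F j) ^+ 2 = \sum_j \sum_l F j * F l.
Proof. by rewrite expr2 mulr_suml; apply: eq_bigr => j _; rewrite mulr_sumr. Qed.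

Lemma cauchy_schwarz_sum (R : realType) (J : finType) (F G : J -> R) :
  (\sum_j F j * G j) ^+ 2 <= (\sum_j F j ^+ 2) * (\sum_j G j ^+ 2).
Proof.
have E : (\sum_j F j ^+ 2) * (\sum_j G j ^+ 2) =
    \sum_j \sum_l F j ^+ 2 * G l ^+ 2.
  by rewrite mulr_suml; apply: eq_bigr => j _; rewrite mulr_sumr.
have E' : (\sum_j F j ^+ 2) * (\sum_j G j ^+ 2) =
    \sum_j \sum_l F l ^+ 2 * G j ^+ 2 by rewrite E exchange_big.
suff : 0 <= (\sum_j F j ^+ 2) * (\sum_j G j ^+ 2) +
    (\sum_j F j ^+ 2) * (\sum_j G j ^+ 2) - 2 * (\sum_j F j * G j) ^+ 2 by lra.
rewrite {1}E E' sqr_sum mulr_sumr -big_split -sumrB /= sumr_ge0// => j _.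
rewrite mulr_sumr -big_split -sumrB sumr_ge0//= => l _.
by have := sqr_ge0 (F j * G l - F l * G j); lra.
Qed.

(** All that is used of the law of a single column: a uniformly chosen [v a] is a unit
vector with covariance I/m and a symmetric law, and its inner product with a
vector of the same family has fourth moment at most [kappa]. *)
Record isotropic (R : realType) (V : finType) (m : nat) (v : V -> 'I_m -> R)
    (kappa : R) : Prop := Isotropic {
  isotropic_card : (0 < #|V|)%N ;
  isotropic_dim : (0 < m)%N ;
  isotropic_unit : forall a, dot (v a) (v a) = 1 ;
  isotropic_cov : forall x, avg (fun a => dot (v a) x ^+ 2) = dot x x / m%:R ;
  isotropic_pow4 : forall b, avg (fun a => dot (v a) (v b) ^+ 4) <= kappa ;
  isotropic_neg : exists2 neg : V -> V, injective neg &
    forall a r, v (neg a) r = - v a r }.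

Section Resampling.
Context {R : realType} {V : finType} {n : nat}.
Local Notation Omega := {ffun 'I_n -> V}.
Implicit Types (w : Omega) (k : 'I_n) (F : Omega -> R).

Definition upd w k (a : V) : Omega := [ffun j => if j == k then a else w j].

Lemma upd_same w k a : upd w k a k = a.
Proof. by rewrite ffunE eqxx. Qed.

Lemma upd_other w k a j : j != k -> upd w k a j = w j.
Proof. by rewrite ffunE => /negPf ->. Qed.

Lemma card_config_gt0 : (0 < #|V|)%N -> (0 < #|Omega|)%N.
Proof. by move=> V0; rewrite card_ffun expn_gt0 V0. Qed.

(** Integration over column k first. Exchanging the value at k with the extra
argument is an involution of the pairs (configuration, value). *)
Lemma avg_resample k F : (0 < #|V|)%N ->
  avg F = avg (fun w => avg (fun a => F (upd w k a))).
Proof.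
move=> V0; rewrite /avg -mulr_suml.
(* Both double averages run over the pairs exchanged by this involution. *)
pose h (p : Omega * V) := (upd p.1 k p.2, p.1 k).
have hK : involutive h.
  case=> w a; rewrite /h /= upd_same; congr (_, _).
  apply/ffunP => j; have [->|jk] := eqVneq j k; first by rewrite upd_same.
  by rewrite !upd_other.
have -> : \sum_(w : Omega) \sum_a F (upd w k a) =
    \sum_(p : Omega * V) F (h p).1.
  by rewrite (pair_big xpredT xpredT (fun w a => F (upd w k a))).
rewrite -(reindex_inj (inv_inj hK) (P := xpredT) (F := fun p : Omega * V => F p.1)) /=.
rewrite -(pair_big xpredT xpredT (fun (w : Omega) (a : V) => F w)) /=.
under [in RHS]eq_bigr do rewrite sumr_const -mulr_natr.
rewrite -mulr_suml mulfK// pnatr_eq0 -lt0n//.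
Qed.

(** Independence of column k. *)
Definition inv_at k F := forall w a, F (upd w k a) = F w.

Lemma upd_inj k (neg : V -> V) : injective neg ->
  injective (fun w => upd w k (neg (w k))).
Proof.
move=> negI w w' /ffunP ww'; apply/ffunP => j; have := ww' j.
by rewrite !ffunE; case: eqP => [->|//]; exact: negI.
Qed.

End Resampling.

Section QuadraticForm.
Context {R : realType} {V : finType} {m n : nat}.
Variables (v : V -> 'I_m -> R) (kappa : R) (vP : isotropic v kappa).
Local Notation Omega := {ffun 'I_n -> V}.
Implicit Types (w : Omega) (j k l : 'I_n) (c : 'I_n -> 'I_n -> R) (G : Omega -> R).

Definition gram w j l : R := dot (v (w j)) (v (w l)).

Definition quad c w : R := 2^-1 * \sum_j \sum_l c j l * gram w j l.

(** The part of [quad c] that involves column k. *)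
Definition incr c k w : R := \sum_j c j k * gram w j k.

(** The second moment of [incr c k] given the other columns, by [condvarE] and
[avg_incr2_inv_at]. *)
Definition condvar c k w : R :=
  (\sum_j \sum_l c j k * c l k * gram w j l) / m%:R.

Definition hollow_sym c := (forall j l, c j l = c l j) /\ (forall k, c k k = 0).

Let V0 := isotropic_card vP.

Let m0 : m%:R != 0 :> R.
Proof. by rewrite pnatr_eq0 -lt0n (isotropic_dim vP). Qed.

Lemma gramC w j l : gram w j l = gram w l j.
Proof. exact: dotC. Qed.

Lemma gram_self w j : gram w j j = 1.
Proof. exact: isotropic_unit vP _. Qed.

Lemma gram_upd w k a j l : j != k -> l != k -> gram (upd w k a) j l = gram w j l.
Proof. by move=> jk lk; rewrite /gram !upd_other. Qed.

Lemma gram_upd_same w k a j : j != k ->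
  gram (upd w k a) j k = dot (v a) (v (w j)).
Proof. by move=> jk; rewrite /gram upd_same upd_other// dotC. Qed.

Lemma quad_incr c w : hollow_sym c -> quad c w = 2^-1 * \sum_k incr c k w.
Proof. by move=> cP; rewrite /quad exchange_big. Qed.

Lemma incr_upd c k w a : hollow_sym c ->
  incr c k (upd w k a) = dot (v a) (fun r => \sum_j c j k * v (w j) r).
Proof.
move=> [_ c0]; rewrite dot_sumr; apply: eq_bigr => j _.
have [->|jk] := eqVneq j k; first by rewrite c0 !mul0r.
by rewrite gram_upd_same.
Qed.

Lemma condvarE c k w :
  condvar c k w = dot (fun r => \sum_j c j k * v (w j) r)
                      (fun r => \sum_j c j k * v (w j) r) / m%:R.
Proof.
rewrite dot_sumr /condvar; congr (_ / _); apply: eq_bigr => j _.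
rewrite dotC dot_sumr mulr_sumr; apply: eq_bigr => l _.
by rewrite mulrA.
Qed.

Lemma condvar_ge0 c k w : 0 <= condvar c k w.
Proof. by rewrite condvarE mulr_ge0 ?invr_ge0 ?ler0n// dot_ge0. Qed.

Lemma condvar_inv_at c k : hollow_sym c -> inv_at k (condvar c k).
Proof.
move=> [_ c0] w a; congr (_ / _); apply: eq_bigr => j _; apply: eq_bigr => l _.
have [->|jk] := eqVneq j k; first by rewrite c0 !mul0r.
have [->|lk] := eqVneq l k; first by rewrite c0 mulr0 !mul0r.
by rewrite gram_upd.
Qed.

Lemma rest_inv_at c k : hollow_sym c ->
  inv_at k (fun w => quad c w - incr c k w).
Proof.
move=> [cs c0].
have E w : quad c w - incr c k w =
    2^-1 * \sum_(j | j != k) \sum_(l | l != k) c j l * gram w j l.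
  have -> : quad c w = 2^-1 * (incr c k w +
      \sum_(j | j != k) (c j k * gram w j k +
        \sum_(l | l != k) c j l * gram w j l)).
    rewrite /quad (bigD1 k)//=; congr (_ * (_ + _)).
      by apply: eq_bigr => l _; rewrite cs gramC.
    by apply: eq_bigr => j _; rewrite (bigD1 k).
  rewrite big_split /=.
  have -> : \sum_(j | j != k) c j k * gram w j k = incr c k w.
    by rewrite /incr [RHS](bigD1 k)//= c0 mul0r add0r.
  by field.
move=> w a; rewrite !E; congr (_ * _); apply: eq_bigr => j jk.
by apply: eq_bigr => l lk; rewrite gram_upd.
Qed.

(** Negating column k negates the increment and nothing else. *)
Lemma avg_incr_inv_at c k G : hollow_sym c -> inv_at k G ->
  avg (fun w => incr c k w * G w) = 0.
Proof.
move=> cP Gk; have [neg negI vneg] := isotropic_neg vP.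
apply: (avg_odd (upd_inj (k := k) negI)) => w; rewrite Gk -mulNr; congr (_ * _).
rewrite /incr -sumrN; apply: eq_bigr => j _.
have [->|jk] := eqVneq j k; first by rewrite cP.2 !mul0r oppr0.
rewrite gram_upd_same// /gram -mulrN; congr (_ * _).
rewrite dotC -sumrN; apply: eq_bigr => r _; by rewrite vneg mulrN.
Qed.

Lemma avg_incr2_inv_at c k G : hollow_sym c -> inv_at k G ->
  avg (fun w => incr c k w ^+ 2 * G w) = avg (fun w => condvar c k w * G w).
Proof.
move=> cP Gk; rewrite (avg_resample k _ V0); apply: eq_avg => w.
transitivity (avg (fun a => G w * dot (v a) (fun r => \sum_j c j k * v (w j) r) ^+ 2)).
  by apply: eq_avg => a; rewrite incr_upd// Gk mulrC.
by rewrite avgZ (isotropic_cov vP) condvarE mulrC.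
Qed.

Lemma avg_gram j l : j != l -> avg (fun w => gram w j l) = 0.
Proof.
move=> jl; have [neg negI vneg] := isotropic_neg vP.
apply: (avg_odd (upd_inj (k := j) negI)) => w.
rewrite gramC gram_upd_same 1?eq_sym// /gram -sumrN.
by apply: eq_bigr => r _; rewrite vneg mulNr.
Qed.

Lemma avg_condvar c k : avg (condvar c k) = (\sum_j c j k ^+ 2) / m%:R.
Proof.
have -> : avg (condvar c k) =
    m%:R^-1 * avg (fun w => \sum_j \sum_l c j k * c l k * gram w j l).
  by rewrite -avgZ; apply: eq_avg => w; rewrite mulrC.
rewrite mulrC avg_sum; congr (_ / _); apply: eq_bigr => j _.
rewrite avg_sum (bigD1 j)//= big1 ?addr0.
  under eq_avg do rewrite gram_self mulr1 -expr2.
  by rewrite avg_cst// card_config_gt0.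
by move=> l lj; rewrite avgZ avg_gram ?mulr0// eq_sym.
Qed.

Lemma avg_incr2 c k : hollow_sym c ->
  avg (fun w => incr c k w ^+ 2) = (\sum_j c j k ^+ 2) / m%:R.
Proof.
move=> cP; rewrite -avg_condvar.
have := @avg_incr2_inv_at c k (fun=> 1) cP (fun _ _ => erefl).
by under eq_avg do rewrite mulr1; under [RHS]eq_avg do rewrite mulr1.
Qed.

Definition qvar c : R := 2^-1 * \sum_k \sum_j c j k ^+ 2 / m%:R.

(** Since [incr c k] is orthogonal to [quad c - incr c k], the identity
X = 1/2 sum_k D_k gives E X^2 = 1/2 sum_k E (D_k X) = 1/2 sum_k E D_k^2. *)
Lemma avg_quad2 c : hollow_sym c -> avg (fun w => quad c w ^+ 2) = qvar c.
Proof.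
move=> cP.
transitivity (2^-1 * \sum_k avg (fun w =>
    incr c k w * (quad c w - incr c k w) + incr c k w ^+ 2)).
  rewrite -avg_sum -avgZ; apply: eq_avg => w.
  rewrite expr2 {1}quad_incr// -mulrA mulr_suml; congr (_ * _).
  by apply: eq_bigr => k _; ring.
congr (_ * _); apply: eq_bigr => k _.
by rewrite avgD avg_incr_inv_at ?add0r ?avg_incr2 -?mulr_suml//; exact: rest_inv_at.
Qed.

Lemma avg_gram2 j l G : j != l -> inv_at j G ->
  avg (fun w => gram w j l ^+ 2 * G w) = avg G / m%:R.
Proof.
move=> jl Gj; rewrite (avg_resample j _ V0) mulrC -avgZ; apply: eq_avg => w.
transitivity (avg (fun a => G w * dot (v a) (v (w l)) ^+ 2)).
  by apply: eq_avg => a; rewrite gramC gram_upd_same 1?eq_sym// Gj mulrC.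
by rewrite avgZ (isotropic_cov vP) (isotropic_unit vP) mul1r mulrC.
Qed.

Lemma avg_gram4 j l : j != l -> avg (fun w => gram w j l ^+ 4) <= kappa.
Proof.
move=> jl; rewrite (avg_resample j _ V0).
rewrite -[leRHS](avg_cst _ (card_config_gt0 (n := n) V0)).
apply: le_avg => w; apply: le_trans (isotropic_pow4 vP (w l)).
by apply: le_avg => a; rewrite gramC gram_upd_same// eq_sym.
Qed.

Let kappa_ge0 : 0 <= kappa.
Proof.
have /card_gt0P[b _] := V0; apply: le_trans (isotropic_pow4 vP b).
by apply: avg_ge0 => a; rewrite exprn_even_ge0.
Qed.

(** Negating column j <> k changes the sign of the j-th term of the increment only,
so [avg_pow4_sign_symmetric] applies. In the resulting double sum the squared
inner products of column k with two other columns are uncorrelated, because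
column k has norm 1. *)
Lemma avg_incr4 c k : hollow_sym c ->
  avg (fun w => incr c k w ^+ 4) <=
    3 * (kappa * \sum_j c j k ^+ 4 + ((\sum_j c j k ^+ 2) / m%:R) ^+ 2).
Proof.
move=> cP; have c0 := cP.2.
apply: le_trans (avg_pow4_sign_symmetric (x := fun j w => c j k * gram w j k) _) _.
  have [neg negI vneg] := isotropic_neg vP.
  exists (fun j w => if j == k then w else upd w j (neg (w j))) => j.
  have [->|jk] := eqVneq j k.
    by split=> // w; rewrite c0 !mul0r oppr0.
  split; first exact: upd_inj.
    move=> w; rewrite gramC gram_upd_same 1?eq_sym// /gram -mulrN -sumrN.
    by congr (_ * _); apply: eq_bigr => r _; rewrite vneg mulNr.
  by move=> l w lj; rewrite gram_upd// eq_sym.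
rewrite ler_pM2l//.
under eq_avg do rewrite sqr_sum.
rewrite avg_sum exprMn sqr_sum mulr_sumr mulr_suml -big_split /=.
apply: ler_sum => j _; rewrite avg_sum.
have [->|jk] := eqVneq j k.
  rewrite big1; last first.
    by move=> l _; rewrite c0; under eq_avg do rewrite mul0r expr0n /= mul0r;
       rewrite /avg sumr_const mul0rn mul0r.
  rewrite addr_ge0 ?mulr_ge0 ?exprn_ge0 ?invr_ge0 ?c0//.
  by apply: sumr_ge0 => l _; rewrite mulr_ge0 ?sqr_ge0.
rewrite (bigD1 j)//= lerD//.
  under eq_avg => w.
    rewrite (_ : _ * _ = c j k ^+ 4 * gram w j k ^+ 4); last by ring.
    over.
  by rewrite avgZ mulrC ler_wpM2r ?avg_gram4// exprn_even_ge0.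
rewrite mulr_suml [leRHS](bigD1 j)//= ler_wpDl//.
  by rewrite mulr_ge0 ?exprn_ge0 ?invr_ge0// -expr2 sqr_ge0.
apply: ler_sum => l lj.
have [->|lk] := eqVneq l k.
  under eq_avg do rewrite c0 mul0r expr0n /= mulr0.
  by rewrite c0 expr0n /= mulr0 mul0r /avg sumr_const mul0rn mul0r.
under eq_avg => w.
  rewrite (_ : _ * _ = c j k ^+ 2 * c l k ^+ 2 *
      (gram w j k ^+ 2 * gram w l k ^+ 2)); last by ring.
  over.
rewrite avgZ avg_gram2//; last first.
  by move=> w a; rewrite gram_upd// eq_sym.
have := @avg_gram2 l k (fun=> 1) lk (fun _ _ => erefl).
under eq_avg do rewrite mulr1; move=> ->.
by rewrite avg_cst ?card_config_gt0// mul1r [m%:R^-1 ^+ 2]expr2.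
Qed.

(** Jensen's inequality: [condvar ^+ 2] and [incr ^+ 2 * condvar] have the same
average. *)
Lemma avg_condvar2 c k : hollow_sym c ->
  avg (fun w => condvar c k w ^+ 2) <= avg (fun w => incr c k w ^+ 4).
Proof.
move=> cP.
have E : avg (fun w => condvar c k w ^+ 2) =
    avg (fun w => incr c k w ^+ 2 * condvar c k w).
  by rewrite avg_incr2_inv_at//; exact: condvar_inv_at.
have : avg (fun w => incr c k w ^+ 2 * condvar c k w) <=
    avg (fun w => 2^-1 * incr c k w ^+ 4 + 2^-1 * condvar c k w ^+ 2).
  apply: le_avg => w.
  by have := sqr_ge0 (incr c k w ^+ 2 - condvar c k w); nra.
by rewrite avgD !avgZ -E; lra.
Qed.

Definition half_condvar c w : R := 2^-1 * \sum_k condvar c k w.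

(** The diagonal terms of [condvar] are constant, as the columns are unit vectors.
The remaining ones form a quadratic form with coefficient matrix c c^T / m off the
diagonal; its second moment is given by [avg_quad2], and the Frobenius norm of
c c^T is at most the square of that of c. *)
Lemma avg_half_condvar_dev c : hollow_sym c ->
  avg (fun w => (half_condvar c w - qvar c) ^+ 2) <= 2 * qvar c ^+ 2 / m%:R.
Proof.
move=> [cs c0].
(* The off-diagonal part of c c^T / m. *)
pose e j l : R := if j == l then 0 else (\sum_k c j k * c l k) / m%:R.
have eP : hollow_sym e.
  split=> [j l|k]; last by rewrite /e eqxx.
  rewrite /e eq_sym; case: eqP => // _; congr (_ / _).
  by apply: eq_bigr => k _; rewrite mulrC.
have E w : half_condvar c w - qvar c = quad e w.
  rewrite /half_condvar /qvar /quad -mulrBr; congr (_ * _).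
  rewrite -sumrB.
  transitivity (\sum_k \sum_j \sum_(l | l != j) c j k * c l k * gram w j l / m%:R).
    apply: eq_bigr => k _; rewrite /condvar mulr_suml -sumrB.
    apply: eq_bigr => j _; rewrite mulr_suml (bigD1 j)//= gram_self mulr1 -expr2.
    by rewrite addrAC subrr add0r.
  rewrite exchange_big /=; apply: eq_bigr => j _.
  rewrite exchange_big /= [RHS](bigD1 j)//= /e eqxx mul0r add0r.
  apply: eq_bigr => l lj; rewrite eq_sym (negPf lj).
  by rewrite !mulr_suml; apply: eq_bigr => k _; rewrite mulrAC.
under eq_avg do rewrite E.
rewrite avg_quad2// /qvar.
set s := \sum_k \sum_j c j k ^+ 2 / m%:R; have s0 : 0 <= s.
  by apply: sumr_ge0 => k _; apply: sumr_ge0 => j _; rewrite mulr_ge0 ?invr_ge0 ?sqr_ge0.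
rewrite (_ : 2 * _ / _ = 2^-1 * (s ^+ 2 / m%:R)); last by field.
rewrite ler_pM2l ?invr_gt0//.
rewrite [leLHS](_ : _ = (\sum_k \sum_j e j k ^+ 2) / m%:R); last first.
  by rewrite mulr_suml; apply: eq_bigr => k _; rewrite mulr_suml.
rewrite ler_wpM2r ?invr_ge0// sqr_sum.
apply: ler_sum => k _; apply: ler_sum => j _; rewrite /e.
case: eqP => [_|_].
  by rewrite expr0n mulr_ge0// sumr_ge0// => i _; rewrite mulr_ge0 ?invr_ge0 ?sqr_ge0.
rewrite -!mulr_suml exprMn [leRHS]mulrACA -expr2 ler_wpM2r ?sqr_ge0//.
under [X in _ <= X * _]eq_bigr do rewrite cs.
under [X in _ <= _ * X]eq_bigr do rewrite cs.
by rewrite [leRHS]mulrC; exact: cauchy_schwarz_sum.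
Qed.

Section SteinBound.
Variables (c : 'I_n -> 'I_n -> R) (cP : hollow_sym c).
Variables (f f1 : R -> R) (L B : R).
Hypotheses (L0 : 0 <= L) (B0 : 0 <= B).
Hypothesis taylor : forall x y, `|f y - f x - f1 x * (y - x)| <= L * (y - x) ^+ 2.
Hypothesis lip : forall x y, `|f1 y - f1 x| <= L * `|y - x|.
Hypothesis bnd : forall x, `|f1 x| <= B.
Variables (eta : R) (eta0 : 0 < eta).

(** This turns third moments into second and fourth moments. *)
Let young (x : R) : `|x| <= eta + (4 * eta)^-1 * x ^+ 2.
Proof.
have h0 : 0 < 4 * eta by rewrite mulr_gt0.
rewrite -(ler_pM2l h0) mulrDr mulrA divff ?gt_eqF// mul1r -real_normK ?num_real//.
by have := sqr_ge0 (`|x| - 2 * eta); nra.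
Qed.

(** One term of Stein's identity. With Y = X - D_k, which does not depend on column k,
D_k f(Y) averages to zero and D_k^2 f'(Y) can be replaced by [condvar * f'(Y)].
What remains are the Taylor remainder, of size |D_k|^3, and the cost of going back
from f'(Y) to f'(X), of size [condvar] times |D_k|. *)
Let swap_bound k :
  `|avg (fun w => incr c k w * f (quad c w)) -
    avg (fun w => condvar c k w * f1 (quad c w))| <=
  L * (eta * (2 * ((\sum_j c j k ^+ 2) / m%:R)) +
       (4 * eta)^-1 * (2 * avg (fun w => incr c k w ^+ 4))).
Proof.
pose Y w := quad c w - incr c k w.
have Yk : inv_at k Y by exact: rest_inv_at.
have Fk (F : R -> R) : inv_at k (F \o Y) by move=> w a; rewrite /= Yk.
have e1 := avg_incr_inv_at cP (Fk f).
have e2 := avg_incr2_inv_at cP (Fk f1).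
set h := (4 * eta)^-1; have h0 : 0 <= h by rewrite invr_ge0 mulr_ge0// ltW.
have -> : avg (fun w => incr c k w * f (quad c w)) -
    avg (fun w => condvar c k w * f1 (quad c w)) =
  avg (fun w => incr c k w * (f (quad c w) - f (Y w) - f1 (Y w) * incr c k w) +
    condvar c k w * (f1 (Y w) - f1 (quad c w))).
  transitivity (avg (fun w => incr c k w * f (quad c w) -
      incr c k w * (f \o Y) w - incr c k w ^+ 2 * (f1 \o Y) w +
      (condvar c k w * (f1 \o Y) w - condvar c k w * f1 (quad c w)))).
    by rewrite avgD !avgB e1 e2; ring.
  by apply: eq_avg => w /=; ring.
apply: le_trans (ler_norm_avg _) _.
apply: (@le_trans _ _ (avg (fun w => L * (eta * (incr c k w ^+ 2 + condvar c k w) +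
   h * (3 / 2 * incr c k w ^+ 4 + 2^-1 * condvar c k w ^+ 2))))).
  apply: le_avg => w; apply: le_trans (ler_normD _ _) _.
  rewrite (normrM (incr c k w)) (normrM (condvar c k w)).
  have dY : quad c w - Y w = incr c k w by rewrite /Y; ring.
  have := taylor (Y w) (quad c w); rewrite dY => h1.
  have := lip (Y w) (quad c w); rewrite dY distrC => h2.
  have := young (incr c k w); rewrite -/h => h3.
  have t0 := condvar_ge0 c k w.
  rewrite (ger0_norm t0).
  move: h1 h2 h3 t0; set D := incr c k w; set t := condvar c k w => h1 h2 h3 t0.
  apply: le_trans (lerD (ler_wpM2l (normr_ge0 D) h1) (ler_wpM2l t0 h2)) _.
  rewrite mulrCA [t * _]mulrCA -mulrDr ler_wpM2l//.
  have D2 := sqr_ge0 D.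
  have i1 : `|D| * D ^+ 2 <= (eta + h * D ^+ 2) * D ^+ 2 by rewrite ler_wpM2r.
  have i2 : t * `|D| <= t * (eta + h * D ^+ 2) by rewrite ler_wpM2l.
  have i3 : h * (2 * (t * D ^+ 2)) <= h * (t ^+ 2 + D ^+ 4).
    by rewrite ler_wpM2l//; have := sqr_ge0 (t - D ^+ 2); nra.
  by apply: le_trans (lerD i1 i2) _; lra.
rewrite avgZ avgD !avgZ !avgD !avgZ avg_incr2// (avg_condvar c k).
have := avg_condvar2 k cP; set a4 := avg (fun w => incr c k w ^+ 4) => a2.
rewrite ler_wpM2l// lerD//; first by rewrite ler_pM2l//; lra.
by rewrite ler_wpM2l//; lra.
Qed.

(** The two halves of the bound are the oscillation of the total conditional variance
around 1, paid with the bound on [f1], and the Taylor remainders of [swap_bound],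
paid with its Lipschitz constant. The free parameter [eta] trades second moments
against fourth moments. *)
Lemma stein_bound_quad :
  `|avg (fun w => f1 (quad c w) - quad c w * f (quad c w))| <=
  eta * (2 * L * qvar c + B) +
  (4 * eta)^-1 * (L * \sum_k avg (fun w => incr c k w ^+ 4) +
    B * (4 * qvar c ^+ 2 / m%:R + 2 * (qvar c - 1) ^+ 2)).
Proof.
set h := (4 * eta)^-1; have h0 : 0 <= h by rewrite invr_ge0 mulr_ge0// ltW.
have -> : avg (fun w => f1 (quad c w) - quad c w * f (quad c w)) =
    avg (fun w => (1 - half_condvar c w) * f1 (quad c w)) -
    2^-1 * \sum_k (avg (fun w => incr c k w * f (quad c w)) -
      avg (fun w => condvar c k w * f1 (quad c w))).
  rewrite sumrB -!avg_sum mulrBr -!avgZ opprB addrA.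
  rewrite avgB -avgD; congr (_ - _).
    apply: eq_avg => w; rewrite -mulr_suml /half_condvar; ring.
  by apply: eq_avg => w; rewrite -mulr_suml quad_incr//; ring.
apply: le_trans (ler_normB _ _) _.
have b1 : `|avg (fun w => (1 - half_condvar c w) * f1 (quad c w))| <=
    B * (eta + h * (4 * qvar c ^+ 2 / m%:R + 2 * (qvar c - 1) ^+ 2)).
  apply: le_trans (ler_norm_avg _) _.
  apply: (@le_trans _ _ (avg (fun w => B * (eta + h *
      (2 * (half_condvar c w - qvar c) ^+ 2 + 2 * (qvar c - 1) ^+ 2))))).
    apply: le_avg => w; rewrite normrM mulrC.
    apply: ler_pM => //; apply: le_trans (young _) _.
    rewrite lerD2l ler_wpM2l//.
    have := sqr_ge0 ((half_condvar c w - qvar c) - (qvar c - 1)).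
    by nra.
  have N0 := card_config_gt0 (n := n) V0.
  rewrite avgZ avgD avg_cst// avgZ avgD avg_cst// avgZ ler_wpM2l// lerD2l ler_wpM2l//.
  rewrite lerD2r; have := avg_half_condvar_dev cP; lra.
have b2 : `|2^-1 * \sum_k (avg (fun w => incr c k w * f (quad c w)) -
      avg (fun w => condvar c k w * f1 (quad c w)))| <=
    L * (eta * (2 * qvar c) + h * \sum_k avg (fun w => incr c k w ^+ 4)).
  rewrite normrM ger0_norm//.
  apply: (@le_trans _ _ (2^-1 * \sum_k L * (eta * (2 * ((\sum_j c j k ^+ 2) / m%:R)) +
       h * (2 * avg (fun w => incr c k w ^+ 4))))).
    rewrite ler_pM2l//; apply: le_trans (ler_norm_sum _ _ _) _.
    by apply: ler_sum => k _; exact: swap_bound.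
  rewrite -mulr_sumr big_split /= -!mulr_sumr /qvar.
  rewrite [X in _ <= _ * (eta * (2 * (2^-1 * X)) + _)](_ : _ =
    \sum_k (\sum_j c j k ^+ 2) / m%:R); last first.
    by apply: eq_bigr => k _; rewrite mulr_suml.
  by rewrite le_eqVlt; apply/orP; left; apply/eqP; field.
apply: le_trans (lerD b1 b2) _.
by rewrite le_eqVlt; apply/orP; left; apply/eqP; ring.
Qed.

End SteinBound.

End QuadraticForm.

(** * Stein's equation *)

Section SteinEquation.
Context {R : realType}.
Local Notation mu := (@lebesgue_measure R).
Local Notation gauss := (normal_pdf (0 : R) 1).

Definition gauss_mean (g : R -> R) : R := \int[mu]_x (g x * gauss x).

Lemma continuous_gauss : continuous gauss.
Proof. exact: continuous_normal_pdf (oner_neq0 _). Qed.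

(** The reciprocal of the standard normal density. *)
Definition gauss_inv (x : R) : R := (normal_peak (1 : R))^-1 * expR (x ^+ 2 / 2).

Lemma gauss_invM x : gauss_inv x * gauss x = 1.
Proof.
rewrite normal_pdfE ?oner_neq0// /gauss_inv /normal_fun.
rewrite subr0 expr1n mulNr expRN mulrACA mulVf ?gt_eqF ?normal_peak_gt0 ?oner_neq0//.
by rewrite mul1r mulfV// gt_eqF ?expR_gt0.
Qed.

Lemma is_derive_gauss_inv (x : R) : is_derive x 1 gauss_inv (x * gauss_inv x).
Proof.
have -> : gauss_inv = (normal_peak (1 : R))^-1 \*: (expR \o (fun x : R => 2^-1 * x ^+ 2)).
  by apply/funext => y; rewrite /gauss_inv /= mulrC [_ ^+ 2 / 2]mulrC mulrC.
have H : is_derive x 1 (fun x : R => 2^-1 * x ^+ 2) x.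
  have -> : (fun x : R => 2^-1 * x ^+ 2) = 2^-1 \*: (id ^+ 2) by [].
  apply: is_derive_eq; rewrite /GRing.scale /= mulr1 expr1; by field.
have H2 := is_derive1_comp (is_derive_expR _) H.
apply: is_derive_eq.
transitivity (x * ((normal_peak (1 : R))^-1 * expR (2^-1 * x ^+ 2))) => //.
by rewrite /GRing.scale /=; ring.
Qed.

Lemma integrable_gaussM (h : R -> R) (K : R) : continuous h ->
  (forall x, `|h x| <= K) -> mu.-integrable setT (fun x => (h x * gauss x)%:E).
Proof.
move=> hc hK.
have mh : measurable_fun [set: R] h by exact: continuous_measurable_fun.
have mg : measurable_fun [set: R] gauss by exact: measurable_normal_pdf.
apply: (@le_integrable _ _ _ mu setT measurableT _ (fun x => (K%:E * (gauss x)%:E)%E)).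
- by apply/measurable_EFinP; exact: measurable_funM.
- move=> x _; rewrite -EFinM !abse_EFin lee_fin !normrM.
  rewrite ler_wpM2r// (le_trans (hK x))// ler_norm//.
- by apply: integrableZl => //; exact: integrable_normal_pdf.
Qed.

Lemma is_derive_continuous (g dg : R -> R) :
  (forall x : R, is_derive x 1 g (dg x)) -> continuous g.
Proof.
by move=> gd x; apply: differentiable_continuous; apply/derivable1_diffP; exact: ex_derive.
Qed.

Lemma lipschitz_continuous (h : R -> R) (K : R) :
  (forall x y, `|h y - h x| <= K * `|y - x|) -> continuous h.
Proof.
move=> hL; have K0 : 0 <= K.
  by have := le_trans (normr_ge0 _) (hL 0 1); rewrite subr0 normr1 mulr1.
move=> x; apply/cvgrPdist_le => e e0; near=> y.
rewrite (le_trans (hL _ _))//.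
have : `|x - y| <= e / (K + 1).
  near: y; apply: cvgr_dist_le; first exact: cvg_id.
  by rewrite divr_gt0// ltr_wpDl.
rewrite ler_pdivlMr ?ltr_wpDl// => ye; apply: le_trans ye.
by rewrite mulrC ler_wpM2l// lerDl.
Unshelve. all: by end_near. Qed.

Lemma lipschitz_of_bounded_derivative (g dg : R -> R) (K : R) :
  (forall x : R, is_derive x 1 g (dg x)) -> (forall x, `|dg x| <= K) ->
  forall x y, `|g y - g x| <= K * `|y - x|.
Proof.
move=> gd dgK; have gc := is_derive_continuous gd.
suff H x y : x <= y -> `|g y - g x| <= K * `|y - x|.
  move=> x y; have [/H//|/ltW/H] := leP x y.
  by rewrite distrC (distrC x).
move=> xy; have [z _ ->] := MVT_segment xy (fun z _ => gd z) (continuous_subspaceT gc).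
by rewrite normrM ler_wpM2r.
Qed.

Lemma taylor_of_lipschitz_derivative (g dg : R -> R) (K : R) : 0 <= K ->
  (forall x : R, is_derive x 1 g (dg x)) ->
  (forall x y, `|dg y - dg x| <= K * `|y - x|) ->
  forall x y, `|g y - g x - dg x * (y - x)| <= K * (y - x) ^+ 2.
Proof.
move=> K0 gd dgK; have gc := is_derive_continuous gd.
have key x y z : `|z - x| <= `|y - x| ->
    `|dg z * (y - x) - dg x * (y - x)| <= K * (y - x) ^+ 2.
  move=> zx; rewrite -mulrBl normrM -(real_normK (num_real (y - x))) expr2 mulrA.
  by rewrite ler_wpM2r// (le_trans (dgK x z))// ler_wpM2l.
move=> x y; have [xy|/ltW yx] := leP x y.
  have [z zi ->] := MVT_segment xy (fun z _ => gd z) (continuous_subspaceT gc).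
  apply: key; move: zi; rewrite in_itv /= => /andP[xz zy].
  by rewrite !ger0_norm ?subr_ge0//; lra.
have [z zi e] := MVT_segment yx (fun z _ => gd z) (continuous_subspaceT gc).
rewrite -(opprB (g x)) e -mulrN opprB.
apply: key; move: zi; rewrite in_itv /= => /andP[xz zy].
by rewrite !ler0_norm ?subr_le0//; lra.
Qed.

(** The solution is f(x) = H(x) / phi(x), where phi is the normal density and H(x) the
integral of h phi over ]-oo, x]. The hypotheses on h make H vanish outside
[-A, A], so f and x f(x) have compact support and bounded derivatives. *)
Lemma stein_equation (h : R -> R) (K A : R) : 0 <= A ->
  (forall x y, `|h y - h x| <= K * `|y - x|) ->
  (forall x, `|h x| <= K) -> (forall x, A <= `|x| -> h x = 0) ->
  gauss_mean h = 0 ->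
  exists f f1 : R -> R, exists L B : R,
    [/\ 0 <= L /\ 0 <= B, forall x, f1 x - x * f x = h x,
        forall x y, `|f y - f x - f1 x * (y - x)| <= L * (y - x) ^+ 2,
        forall x y, `|f1 y - f1 x| <= L * `|y - x| &
        forall x, `|f1 x| <= B].
Proof.
move=> A0 hL hK hA h0.
have K0 : 0 <= K := le_trans (normr_ge0 _) (hK 0).
have hc : continuous h := lipschitz_continuous hL.
pose p x := h x * gauss x.
have pc : continuous p by move=> x; apply: continuousM; [exact: hc|exact: continuous_gauss].
have pint := integrable_gaussM hc hK.
have pintS (D : set R) : measurable D -> mu.-integrable D (EFin \o p).
  by move=> mD; apply: integrableS pint.
have pA x : A <= `|x| -> p x = 0 by move=> /hA hx; rewrite /p hx mul0r.
pose H (x : R) : R := \int[mu]_(t in `]-oo, x]) p t.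
have Hd (x : R) : is_derive x 1 H (p x).
  have [||||d1] := @continuous_FTC1 R p -oo%O x (x + 1).
  - by rewrite ltrDl.
  - by apply: pintS; exact: measurable_itv.
  - exact: ltNyr.
  - exact: pc.
  by rewrite derive1E => <-; exact: derivableP.
(* The integrand vanishes outside [-A, A]. *)
have p0 (D : set R) : (forall x, D x -> A <= `|x|) -> \int[mu]_(t in D) p t = 0.
  move=> DA; rewrite /Rintegral integral0_eq// => x Dx /=.
  by rewrite pA ?DA.
have HA x : A <= `|x| -> H x = 0.
  rewrite ler_normr => /orP[Ax|xA]; last first.
    apply: p0 => y /=; rewrite in_itv /= => yx.
    by rewrite ler_normr; apply/orP; right; lra.
  have := @Rintegral_itvB R p -oo%O +oo%O x.
  rewrite set_itvNyy => /(_ pint isT isT).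
  rewrite [X in X - _ = _](_ : _ = 0)// sub0r => E.
  rewrite -[LHS]opprK E p0 ?oppr0// => y /=; rewrite in_itv /= andbT => xy.
  by rewrite ler_normr; apply/orP; left; lra.
pose f x := H x * gauss_inv x.
pose f1 x := x * f x + h x.
have fd (x : R) : is_derive x 1 f (f1 x).
  have := is_deriveM (Hd x) (is_derive_gauss_inv x).
  rewrite /GRing.scale /= => D; apply: is_derive_eq; rewrite /f1 /f.
  by rewrite -[h x]mulr1 -(gauss_invM x) /p; ring.
have fA x : A <= `|x| -> f x = 0 by move=> /HA Hx; rewrite /f Hx mul0r.
have fc : continuous f := is_derive_continuous fd.
have [F F0 fF] : exists2 F : R, 0 <= F & forall x, `|f x| <= F.
  have [M [_ MP]] := compact_bounded (continuous_compact
    (continuous_subspaceT (A := `[- A, A]) fc) (@segment_compact _ _ _)).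
  (* A bound strictly larger than M, as boundedness only speaks of these. *)
  exists (`|M| + 1) => [|x]; first by rewrite addr_ge0.
  have [xA|/ltW/fA ->] := leP `|x| A; last by rewrite normr0 addr_ge0.
  apply: MP; first by rewrite (le_lt_trans (ler_norm M))// ltrDl.
  by exists x => //=; rewrite in_itv /= -ler_norml.
pose B := A * F + K.
have B0 : 0 <= B by rewrite addr_ge0// mulr_ge0.
have f1B x : `|f1 x| <= B.
  apply: le_trans (ler_normD _ _) _; apply: lerD => //.
  rewrite normrM; have [xA|/ltW/fA ->] := leP `|x| A; last first.
    by rewrite normr0 mulr0 mulr_ge0.
  by rewrite ler_pM.
have xfd (x : R) : is_derive x 1 (fun x => x * f x) (f x + x * f1 x).
  have := is_deriveM (is_derive_id x 1) (fd x).
  rewrite /GRing.scale /= => D; apply: is_derive_eq; rewrite /=.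
  by rewrite mulr1 addrC.
have xfL := @lipschitz_of_bounded_derivative _ _ (F + A * B) xfd.
have f1L x y : `|f1 y - f1 x| <= (F + A * B + K) * `|y - x|.
  rewrite /f1 opprD addrACA (le_trans (ler_normD _ _))// mulrDl lerD//.
  apply: xfL => z; rewrite (le_trans (ler_normD _ _))// lerD// normrM.
  have [zA|/ltW zA] := leP `|z| A; first by rewrite ler_pM.
  by rewrite /f1 fA// hA// mulr0 addr0 normr0 mulr0 mulr_ge0.
have L0 : 0 <= F + A * B + K by rewrite !addr_ge0// mulr_ge0.
exists f, f1, (F + A * B + K), B; split=> //.
- by move=> x; rewrite /f1 addrC addKr.
- exact: taylor_of_lipschitz_derivative.
Qed.

End SteinEquation.

(** * Stein's criterion for distribution functions *)

Section Plateau.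
Context {R : realType}.
Implicit Types c r d t : R.

(** For 0 <= r: equal to 1 on [c - r, c + r], to 0 outside [c - r - d, c + r + d], and affine in
between. *)
Definition plateau c r d t : R := Num.max 0 (Num.min 1 (1 + (r - `|t - c|) / d)).

Lemma plateau_ge0 c r d t : 0 <= plateau c r d t.
Proof. by rewrite le_max lexx. Qed.

Lemma plateau_le1 c r d t : plateau c r d t <= 1.
Proof. by rewrite ge_max ler01 ge_min lexx. Qed.

Lemma norm_plateau_le1 c r d t : `|plateau c r d t| <= 1.
Proof. by rewrite ger0_norm ?plateau_ge0 ?plateau_le1. Qed.

Lemma plateau_eq1 c r d t : 0 < d -> `|t - c| <= r -> plateau c r d t = 1.
Proof.
move=> d0 tr; rewrite /plateau min_l ?max_r// lerDl.
by rewrite divr_ge0 ?subr_ge0// ltW.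
Qed.

Lemma plateau_eq0 c r d t : 0 < d -> r + d <= `|t - c| -> plateau c r d t = 0.
Proof.
move=> d0 tr; rewrite /plateau max_l// ge_min; apply/orP; right.
by rewrite -lerBrDl sub0r ler_pdivrMr//; lra.
Qed.

Lemma plateau_lipschitz c r d t u : 0 < d ->
  `|plateau c r d u - plateau c r d t| <= d^-1 * `|u - t|.
Proof.
move=> d0.
have clamp (a b : R) : `|Num.max 0 (Num.min 1 a) - Num.max 0 (Num.min 1 b)| <= `|a - b|.
  rewrite ler_norml; have := ler_norm (a - b); have := ler_norm (b - a); rewrite distrC.
  by case: (leP 1 a) => ?; case: (leP 1 b) => ?; rewrite ?(max_r ler01);
    case: (leP 0 a) => ?; case: (leP 0 b) => ?; move=> *; apply/andP; split; lra.
apply: le_trans (clamp _ _) _.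
rewrite (_ : _ - _ = (`|t - c| - `|u - c|) * d^-1); last by ring.
rewrite normrM mulrC (ger0_norm (x := d^-1)) ?invr_ge0 ?(ltW d0)//.
rewrite ler_pM2l ?invr_gt0// (le_trans (ler_dist_dist _ _))//.
by rewrite (_ : _ - _ = t - u) 1?distrC//; ring.
Qed.

End Plateau.

Section SteinCriterion.
Context {R : realType}.
Local Notation mu := (@lebesgue_measure R).
Local Notation gauss := (normal_pdf (0 : R) 1).

Definition gauss_cdf (x : R) : R := \int[mu]_(t in `]-oo, x]) gauss t.

Lemma normal_prob_cdf (x : R) : normal_prob 0 1 `]-oo, x] = (gauss_cdf x)%:E.
Proof.
rewrite /gauss_cdf /Rintegral fineK//.
apply: (@integrable_fin_num _ _ _ mu) => //.
exact: integrableS (integrable_normal_pdf 0 1).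
Qed.

Lemma continuous_gauss_cdf : continuous gauss_cdf.
Proof.
move=> x; apply: differentiable_continuous; apply/derivable1_diffP.
have [||||d1 _] // := @continuous_FTC1 R gauss -oo%O x (x + 1).
- by rewrite ltrDl.
- exact: integrableS (integrable_normal_pdf 0 1).
- exact: ltNyr.
- exact: continuous_gauss.
Qed.

Lemma continuous_plateau (c r d : R) : 0 < d -> continuous (plateau c r d).
Proof. by move=> d0; apply: lipschitz_continuous => x y; exact: plateau_lipschitz. Qed.

Lemma integrable_plateauM (c r d : R) : 0 < d ->
  mu.-integrable setT (EFin \o (fun x => plateau c r d x * gauss x)).
Proof.
move=> d0; apply: (integrable_gaussM (K := 1)); first exact: continuous_plateau.
by move=> x; exact: norm_plateau_le1.
Qed.

Lemma integrable_gauss : mu.-integrable setT (EFin \o gauss).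
Proof. exact: integrable_normal_pdf. Qed.

Lemma Rintegral_gauss : \int[mu]_x gauss x = 1.
Proof. by rewrite /Rintegral integral_normal_pdf. Qed.

Lemma gauss_mean_plateau_le1 (c r d : R) : 0 < d -> gauss_mean (plateau c r d) <= 1.
Proof.
move=> d0; rewrite -Rintegral_gauss; apply: le_Rintegral => //.
- exact: integrable_plateauM.
- exact: integrable_gauss.
- by move=> x _; rewrite ler_piMl ?normal_pdf_ge0 ?plateau_le1.
Qed.

Lemma gauss_mean_plateau_ge0 (c r d : R) : 0 <= gauss_mean (plateau c r d).
Proof.
by apply: Rintegral_ge0 => x _; rewrite mulr_ge0 ?normal_pdf_ge0 ?plateau_ge0.
Qed.

Lemma integrable_gauss_patch (D : set R) : measurable D ->
  mu.-integrable setT (EFin \o (gauss \_ D)).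
Proof.
move=> mD; rewrite -restrict_EFin.
have [+ _] := @integrable_mkcond _ _ _ mu D (EFin \o gauss) mD; apply.
exact: (integrableS _ _ _ (integrable_normal_pdf 0 1)).
Qed.

Lemma gauss_mean_le_cdf (c r d x : R) : 0 < d ->
  (forall t, x < t -> plateau c r d t = 0) ->
  gauss_mean (plateau c r d) <= gauss_cdf x.
Proof.
move=> d0 Hx; rewrite /gauss_cdf Rintegral_mkcond; apply: le_Rintegral => //.
- exact: integrable_plateauM.
- exact: integrable_gauss_patch.
move=> t _; rewrite patchE; case: ifPn => [_|].
  by rewrite ler_piMl ?normal_pdf_ge0 ?plateau_le1.
by rewrite notin_setE /= in_itv /= => /negP; rewrite -ltNge => /Hx ->; rewrite mul0r.
Qed.

(** Under the hypothesis, the indicator of ]-oo, x] is at most the first plateau plus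
the complement of the second: the second plateau plays the role of a cutoff. *)
Lemma cdf_le_gauss_mean (c r d c' r' d' x : R) : 0 < d -> 0 < d' ->
  (forall t, t <= x -> plateau c' r' d' t <= plateau c r d t) ->
  gauss_cdf x <= gauss_mean (plateau c r d) + (1 - gauss_mean (plateau c' r' d')).
Proof.
move=> d0 d0' Hx.
have i1 := integrable_plateauM c r d0.
have i2 := integrable_plateauM c' r' d0'.
rewrite -Rintegral_gauss /gauss_mean -RintegralB//; last exact: integrable_gauss.
have i3 : mu.-integrable setT
    (EFin \o (fun t => gauss t - plateau c' r' d' t * gauss t)).
  exact: (integrableB (D := setT) measurableT integrable_gauss i2).
rewrite -RintegralD// /gauss_cdf Rintegral_mkcond; apply: le_Rintegral => //.
- exact: integrable_gauss_patch.
- exact: (integrableD (D := setT) measurableT i1 i3).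
move=> t _; rewrite patchE; have g0 := normal_pdf_ge0 0 1 t.
have p0 := plateau_ge0 c r d t; have p1 := plateau_le1 c' r' d' t.
case: ifPn => [|_]; last first.
  (* Outside its domain a restricted function takes the default value, which is 0. *)
  rewrite [point](_ : _ = 0 :> R)//.
  by have := mulr_ge0 p0 g0; have := ler_wpM2r g0 p1; rewrite mul1r; lra.
by rewrite inE /= in_itv /= => /Hx /(ler_wpM2r g0); lra.
Qed.

Lemma gauss_mean_near1 (e : R) : 0 < e ->
  \forall n \near \oo, 1 - e <= gauss_mean (plateau 0 n%:R 1).
Proof.
move=> e0; pose F (n : nat) : set R := `[- n%:R, n%:R]%classic.
have FT : \bigcup_n F n = setT.
  rewrite -subTset => t _ /=; exists (Num.truncn `|t|).+1 => //=.
  by rewrite /F /= in_itv /= -ler_norml ltW// truncnS_gt.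
have : normal_prob 0 1 (F n) @[n --> \oo] --> (normal_prob 0 1 (\bigcup_n F n) : \bar R).
  apply: nondecreasing_cvg_mu => //.
    move=> n; exact: measurable_itv.
    by apply: bigcup_measurable => n _; exact: measurable_itv.
  move=> n p np; apply/subsetPset => t /=.
  rewrite /F /= !in_itv /= -!ler_norml => /le_trans; apply.
  by rewrite ler_nat.
rewrite FT probability_setT => /fine_cvgP [_] /cvgrPdist_le /(_ e e0).
apply: filterS => n /= H.
have : fine (normal_prob 0 1 (F n)) <= gauss_mean (plateau 0 n%:R 1).
  rewrite [leLHS](_ : _ = \int[mu]_(t in F n) gauss t)// Rintegral_mkcond.
  apply: le_Rintegral => //.
  - by apply: integrable_gauss_patch; exact: measurable_itv.
  - exact: integrable_plateauM.
  move=> t _; have g0 := normal_pdf_ge0 0 1 t.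
  rewrite patchE; case: ifPn => [|_]; last by rewrite mulr_ge0 ?plateau_ge0.
  by rewrite inE /F /= in_itv /= -ler_norml => tn; rewrite plateau_eq1 ?mul1r ?subr0.
by move: H; rewrite ler_norml /= => /andP[]; lra.
Qed.

Lemma gauss_cdf_bounds (x e : R) : 0 < e -> exists2 d : R, 0 < d &
  gauss_cdf (x + d) <= gauss_cdf x + e /\ gauss_cdf x - e <= gauss_cdf (x - d).
Proof.
move=> e0; have /cvgrPdist_le /(_ e e0) := @continuous_gauss_cdf x.
move=> /nbhs_ballP [d /= d0 H]; exists (d / 2); first by rewrite divr_gt0.
have d20 : 0 < d / 2 by rewrite divr_gt0.
have dd : d / 2 < d by rewrite ltr_pdivrMr// ltr_pMr// ltr1n.
have h1 : `|gauss_cdf x - gauss_cdf (x + d / 2)| <= e.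
  by apply: H; rewrite /ball /= opprD addNKr normrN gtr0_norm.
have h2 : `|gauss_cdf x - gauss_cdf (x - d / 2)| <= e.
  by apply: H; rewrite /ball /= opprB addrC subrK gtr0_norm.
by move: h1 h2; rewrite !ler_norml => /andP[? ?] /andP[? ?]; split; lra.
Qed.

Variables (I : nat -> finType) (X : forall n, I n -> R) (C : R).
Hypothesis I0 : \forall n \near \oo, (0 < #|I n|)%N.
Hypothesis X2 : \forall n \near \oo, avg (fun i : I n => X i ^+ 2) <= C.
Hypothesis stein : forall (f f1 : R -> R) (L B : R), 0 <= L -> 0 <= B ->
  (forall x y, `|f y - f x - f1 x * (y - x)| <= L * (y - x) ^+ 2) ->
  (forall x y, `|f1 y - f1 x| <= L * `|y - x|) ->
  (forall x, `|f1 x| <= B) ->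
  avg (fun i : I n => f1 (X i) - X i * f (X i)) @[n --> \oo] --> 0.

(** The coefficient gives the difference of the two plateaus Gaussian mean zero, so
that it is of the form f' - x f. *)
Lemma avg_plateau_ratio (c r d M : R) : 0 < d ->
  0 < gauss_mean (plateau 0 M 1) ->
  avg (fun i : I n => plateau c r d (X i)) -
    gauss_mean (plateau c r d) / gauss_mean (plateau 0 M 1) *
      avg (fun i : I n => plateau 0 M 1 (X i)) @[n --> \oo] --> 0.
Proof.
move=> d0 g0; set lam := _ / _.
have lam0 : 0 <= lam by rewrite divr_ge0 ?(ltW g0)// gauss_mean_plateau_ge0.
pose h t := plateau c r d t - lam * plateau 0 M 1 t.
(* Both plateaus vanish outside [-A, A]. *)
pose A := `|c| + `|r| + d + `|M| + 1.
have A0 : 0 <= A by rewrite !addr_ge0// ltW.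
have di0 : 0 <= d^-1 by rewrite invr_ge0 ltW.
have [||||f [f1 [L [B [[L0 B0] fE fT f1L f1B]]]]] :=
    @stein_equation R h (d^-1 + lam + 1) A A0.
- move=> x y; rewrite /h.
  rewrite (_ : _ - _ = (plateau c r d y - plateau c r d x) -
     lam * (plateau 0 M 1 y - plateau 0 M 1 x)); last by ring.
  rewrite (le_trans (ler_normB _ _))// normrM (ger0_norm lam0).
  have h1 := plateau_lipschitz c r x y d0.
  have := ler_wpM2l lam0 (plateau_lipschitz 0 M x y ltr01).
  by rewrite invr1 mul1r; have := normr_ge0 (y - x); lra.
- move=> x; rewrite /h (le_trans (ler_normB _ _))// normrM (ger0_norm lam0).
  have := norm_plateau_le1 c r d x.
  by have := ler_wpM2l lam0 (norm_plateau_le1 0 M 1 x); lra.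
- move=> x Ax; rewrite /h !plateau_eq0 ?mulr0 ?subr0//.
    have := ler_norm M; move: Ax; rewrite /A.
    by have := normr_ge0 c; have := normr_ge0 r; lra.
  have := ler_norm r; move: Ax; rewrite /A; have := normr_ge0 M.
  by have := lerB_dist x c; lra.
- rewrite /gauss_mean /h.
  rewrite [LHS](_ : _ = \int[mu]_t (plateau c r d t * gauss t -
     lam * (plateau 0 M 1 t * gauss t))); last first.
    by apply: eq_Rintegral => t _; ring.
  rewrite RintegralB//; first 1 last.
  + exact: integrable_plateauM.
  + have := integrableZl (D := setT) measurableT lam (integrable_plateauM 0 M ltr01).
    by apply: eq_integrable.
  rewrite RintegralZl//; last exact: integrable_plateauM.
  by rewrite -!/(gauss_mean _) /lam divfK ?subrr// gt_eqF.
have := stein L0 B0 fT f1L f1B; apply: cvg_trans; apply: near_eq_cvg.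
near=> n; rewrite -avgZ -avgB; apply: eq_avg => i.
by rewrite fE.
Unshelve. all: by end_near. Qed.

(** The arithmetic behind [stein_criterion]: F is the distribution function, u and v
are the averages of plateaus above and below the indicator, p and q their Gaussian
means, and h and g the average and the Gaussian mean of the wide plateau. *)
Lemma ratio_squeeze (e c F t lp lm g p q h u v : R) :
  0 < e -> e <= 2^-1 -> 1 - e <= g -> g <= 1 -> 1 - e <= h -> h <= 1 ->
  0 <= lp -> 0 <= lm -> lp * g = p -> lm * g = q -> p <= 1 -> q <= 1 ->
  - e <= u - lp * h <= e -> - e <= v - lm * h <= e -> t <= e ->
  F <= u + t -> v <= F -> p <= c + e -> c - e <= q + (1 - g) ->
  `|c - F| <= 5 * e.
Proof.
move=> e0 e2 g0 g1 h0 h1 lp0 lm0 lpE lmE p1 q1 /andP[u1 u2] /andP[v1 v2] te Ft vF pc qc.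
have half : 2^-1 <= g by lra.
have lp2 : lp <= 2 by have := ler_wpM2l lp0 half; clear -lpE p1; lra.
have lm2 : lm <= 2 by have := ler_wpM2l lm0 half; clear -lmE q1; lra.
have a1 : lp * (1 - g) <= 2 * e by apply: ler_pM => //; lra.
have a2 : lp * h <= lp by rewrite ler_piMr.
have a3 : lm * (1 - h) <= 2 * e by apply: ler_pM => //; lra.
have a4 : q <= lm by rewrite -lmE ler_piMr.
rewrite ler_norml; apply/andP; split.
  by clear - u2 te Ft pc a1 a2 lpE; lra.
by clear - v1 vF qc a3 a4 g0; lra.
Qed.

(** The indicator of ]-oo, x] lies between two plateaus, up to an error X^2 / M^2 on
the left tail. By [avg_plateau_ratio] their averages are asymptotically their
Gaussian means times the ratio of the average of a plateau on [-M, M] to its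
Gaussian mean, and this ratio is close to 1 for large M. *)
Lemma stein_criterion (x : R) :
  avg (fun i : I n => (X i <= x)%R%:R : R) @[n --> \oo] --> gauss_cdf x.
Proof.
apply/cvgrPdist_le => e0 e0_gt0.
(* By ratio_squeeze the total error is at most 5 e. The bound by 1/2 keeps the
   Gaussian mean of the wide plateau away from 0. *)
pose e := Num.min (2^-1) (e0 / 5).
have e_gt0 : 0 < e by rewrite lt_min invr_gt0 ltr0n divr_gt0.
have e_half : e <= 2^-1 by rewrite ge_min lexx.
have e_e0 : 5 * e <= e0.
  by rewrite mulrC -ler_pdivlMr// ge_min lexx orbT.
have [d d0 [xd1 xd2]] := gauss_cdf_bounds x e_gt0.
have [M [M1 MC gM]] : exists M : R, [/\ 1 <= M, C <= e * M ^+ 2 &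
    1 - e <= gauss_mean (plateau 0 M 1)].
  near \oo => k; exists k%:R.
  have k1 : (1 : R) <= k%:R by rewrite ler1n; near: k; exists 1%N.
  split=> //; last by near: k; exact: gauss_mean_near1.
  have : C / e <= k%:R by near: k; exact: nbhs_infty_ger.
  rewrite ler_pdivrMr// => /le_trans; apply; rewrite mulrC ler_pM2l//.
  by rewrite expr2 ler_peMl// (le_trans ler01).
pose h0 := plateau 0 M 1.
(* gp is 1 on [-M, x] and vanishes beyond x + d; gm is 1 on [-(M+1), x - d] and
   vanishes beyond x. The latter starts at -(M+1) because h0 lives on
   [-(M+1), M+1]. *)
pose gp := plateau ((x - M) / 2) ((x + M) / 2) d.
pose gm := plateau ((x - d - (M + 1)) / 2) ((x - d + (M + 1)) / 2) d.
have g0 : 0 < gauss_mean h0 by rewrite /h0; lra.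
have gle1 := gauss_mean_plateau_le1.
have gp_cdf : gauss_mean gp <= gauss_cdf (x + d).
  apply: gauss_mean_le_cdf => // t xt; apply: plateau_eq0 => //.
  by rewrite ler_normr; apply/orP; left; lra.
have gm_cdf : gauss_cdf (x - d) <= gauss_mean gm + (1 - gauss_mean h0).
  apply: cdf_le_gauss_mean => // t tx.
  have [tM|tM] := leP (- (M + 1)) t.
    rewrite (@plateau_eq1 _ ((x - d - (M + 1)) / 2)) ?plateau_le1//.
    by rewrite ler_norml; apply/andP; split; lra.
  rewrite plateau_eq0 ?plateau_ge0// subr0 ler_normr; apply/orP; right; lra.
have rp := avg_plateau_ratio ((x - M) / 2) ((x + M) / 2) d0 g0.
have rm := avg_plateau_ratio ((x - d - (M + 1)) / 2) ((x - d + (M + 1)) / 2) d0 g0.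
move/cvgrPdist_le : rp => /(_ e e_gt0) rp.
move/cvgrPdist_le : rm => /(_ e e_gt0) rm.
near=> n.
have N0 : (0 < #|I n|)%N by near: n.
have Xn : avg (fun i : I n => X i ^+ 2) <= C by near: n.
have rmn : `|0 - (avg (fun i : I n => gm (X i)) - gauss_mean gm / gauss_mean h0 *
    avg (fun i : I n => h0 (X i)))| <= e by near: n; exact: rm.
have rpn : `|0 - (avg (fun i : I n => gp (X i)) - gauss_mean gp / gauss_mean h0 *
    avg (fun i : I n => h0 (X i)))| <= e by near: n; exact: rp.
have tail : avg (fun i : I n => M ^- 2 * X i ^+ 2) <= e.
  rewrite avgZ (le_trans (ler_wpM2l _ Xn)) ?invr_ge0 ?sqr_ge0//.
  by rewrite mulrC ler_pdivrMr// exprn_gt0// (lt_le_trans ltr01).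
have M2 : 0 < M ^+ 2 by rewrite exprn_gt0// (lt_le_trans ltr01).
have big (t : R) : M < `|t| -> 1 <= M ^- 2 * t ^+ 2.
  move=> Mt; rewrite mulrC ler_pdivlMr// mul1r -(real_normK (num_real t)).
  by rewrite ler_sqr ?nnegrE ?(ltW Mt)// (le_trans ler01).
have pos (t : R) : 0 <= M ^- 2 * t ^+ 2 by rewrite mulr_ge0 ?invr_ge0 ?sqr_ge0.
set hbar := avg (fun i : I n => h0 (X i)).
have hbar1 : hbar <= 1.
  by rewrite -[leRHS](avg_cst _ N0); apply: le_avg => i; exact: plateau_le1.
have hbare : 1 - e <= hbar.
  suff : 1 <= hbar + avg (fun i : I n => M ^- 2 * X i ^+ 2).
    by move: tail; clear; move=> *; lra.
  rewrite -avgD -[leLHS](avg_cst _ N0); apply: le_avg => i.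
  have [tM|tM] := leP `|X i| M; last first.
    by rewrite ler_wpDl ?plateau_ge0// big.
  by rewrite /h0 plateau_eq1 ?subr0// lerDl.
set F := avg _.
have Fp : F <= avg (fun i : I n => gp (X i)) + avg (fun i : I n => M ^- 2 * X i ^+ 2).
  rewrite -avgD; apply: le_avg => i.
  have := pos (X i); have := plateau_ge0 ((x - M) / 2) ((x + M) / 2) d (X i).
  rewrite -/gp => ? ?; have [Xx|_] := leP (X i) x; last by rewrite addr_ge0.
  have [tM|tM] := leP `|X i| M; last first.
    by rewrite ler_wpDl// big.
  rewrite /gp plateau_eq1 ?lerDl//.
  by move: tM d0 Xx; clear; rewrite !ler_norml => /andP[? ?]; move=> *; apply/andP; split; lra.
have Fm : avg (fun i : I n => gm (X i)) <= F.
  apply: le_avg => i; have [Xx|Xx] := leP (X i) x; first exact: plateau_le1.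
  rewrite /gm plateau_eq0// ler_normr; apply/orP; left; lra.
set lp := gauss_mean gp / gauss_mean h0; set lm := gauss_mean gm / gauss_mean h0.
move: rmn rpn; rewrite -/hbar -/lp -/lm.
rewrite !sub0r !normrN => rmn rpn.
have lpE : lp * gauss_mean h0 = gauss_mean gp by rewrite divfK// gt_eqF.
have lmE : lm * gauss_mean h0 = gauss_mean gm by rewrite divfK// gt_eqF.
have lp0 : 0 <= lp by rewrite divr_ge0 ?(ltW g0)// gauss_mean_plateau_ge0.
have lm0 : 0 <= lm by rewrite divr_ge0 ?(ltW g0)// gauss_mean_plateau_ge0.
have gp1 : gauss_mean gp <= 1 by exact: gle1.
have gm1 : gauss_mean gm <= 1 by exact: gle1.
have gh1 : gauss_mean h0 <= 1 by exact: gle1.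
apply: le_trans e_e0.
apply: (@ratio_squeeze e _ F (avg (fun i : I n => M ^- 2 * X i ^+ 2)) lp lm
  (gauss_mean h0) (gauss_mean gp) (gauss_mean gm) hbar
  (avg (fun i : I n => gp (X i))) (avg (fun i : I n => gm (X i)))) => //.
- by rewrite -ler_norml.
- by rewrite -ler_norml.
- exact: le_trans gp_cdf xd1.
- exact: le_trans xd2 gm_cdf.
Unshelve. all: by end_near. Qed.

End SteinCriterion.

(** * Moments of a sparse sign vector *)

Section SparseSignVectors.
Context {R : realType} {m k : nat}.
Hypothesis k0 : (0 < k)%N.
Local Notation A := (@sparse_sign_vectors R m k).

Lemma dotpE (x y : 'cV[R]_m) : dotp x y = \sum_r x r 0 * y r 0.
Proof. by rewrite /dotp !mxE; apply: eq_bigr => r _; rewrite mxE. Qed.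

(** In terms of squares the conditions are visibly invariant under sign changes and
permutations of the coordinates. *)
Lemma sparse_sign_vectorsP (x : 'cV[R]_m) : A x <->
  (forall r, x r 0 ^+ 2 = 0 \/ x r 0 ^+ 2 = k%:R^-1) /\
  \sum_r x r 0 ^+ 2 = 1.
Proof.
have kR : 0 < k%:R :> R by rewrite ltr0n.
have s0 : Num.sqrt k%:R != 0 :> R by rewrite gt_eqF// sqrtr_gt0.
have s2 : Num.sqrt k%:R ^+ 2 = k%:R :> R by rewrite sqr_sqrtr// ltW.
split=> [[f [fs ff] <-]|[xs xx]].
  have E r : ((Num.sqrt k%:R)^-1 *: f) r 0 ^+ 2 = k%:R^-1 * f r 0 ^+ 2.
    by rewrite mxE exprMn exprVn s2.
  split=> [r|].
    rewrite E; have := fs r; rewrite !inE => /or3P[] /eqP ->.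
    - by right; rewrite sqrrN expr1n mulr1.
    - by left; rewrite expr0n mulr0.
    - by right; rewrite expr1n mulr1.
  under eq_bigr do rewrite E expr2.
  by rewrite -mulr_sumr -dotpE ff mulVf// gt_eqF.
exists (Num.sqrt k%:R *: x); last by rewrite scalerA mulVf// scale1r.
split=> [r|].
  have : (Num.sqrt k%:R * x r 0) ^+ 2 = 0 \/ (Num.sqrt k%:R * x r 0) ^+ 2 = 1.
    rewrite exprMn s2; have [->|->] := xs r; first by left; rewrite mulr0.
    by right; rewrite mulfV// gt_eqF.
  rewrite !inE mxE => -[/eqP|/eqP].
    by rewrite sqrf_eq0 => ->; rewrite orbT.
  by rewrite sqrf_eq1 => /orP[] ->; rewrite ?orbT.
transitivity (k%:R * \sum_r x r 0 ^+ 2 : R); last by rewrite xx mulr1.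
rewrite dotpE mulr_sumr; apply: eq_bigr => r _.
by rewrite !mxE; transitivity (Num.sqrt k%:R ^+ 2 * x r 0 ^+ 2); [ring|rewrite s2].
Qed.

Hypothesis finA : finite_set A.

Definition sparse_sign_fin : finType := fset_sub_type (fset_set A).
Local Notation V := sparse_sign_fin.
Definition entry (a : V) (r : 'I_m) : R := (val a : 'cV[R]_m) r 0.

Lemma entryP (a : V) :
  (forall r, entry a r ^+ 2 = 0 \/ entry a r ^+ 2 = k%:R^-1) /\
  \sum_r entry a r ^+ 2 = 1.
Proof.
apply/sparse_sign_vectorsP; have := valP a.
by rewrite in_fset_set// inE.
Qed.

(** Signed permutations of the coordinates act on the sparse sign vectors. Involutions
are enough: they give sign changes and transpositions. *)
Lemma entry_lift (s : 'I_m -> 'I_m) (e : 'I_m -> R) : involutive s ->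
  (forall r, e r ^+ 2 = 1) ->
  exists2 g : V -> V, injective g & forall a r, entry (g a) r = e r * entry a (s r).
Proof.
move=> sK e2.
pose h (x : 'cV[R]_m) : 'cV[R]_m := \col_r (e r * x (s r) 0).
have hA (a : V) : h (val a) \in fset_set A.
  rewrite in_fset_set// inE; apply/sparse_sign_vectorsP.
  have [a1 a2] := entryP a; split=> [r|].
    by rewrite mxE exprMn e2 mul1r; exact: a1.
  rewrite -a2 [RHS](reindex_inj (inv_inj sK)) /=; apply: eq_bigr => r _.
  by rewrite mxE exprMn e2 mul1r.
exists (fun a => [` hA a]%fset) => [a b|a r]; last by rewrite /entry /= mxE.
move=> /(congr1 val) /= /matrixP ab; apply/val_inj/matrixP => r j.
rewrite (ord1 j); have := ab (s r) 0; rewrite !mxE sK; apply: mulfI.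
by apply/eqP => e0; have := e2 (s r); rewrite e0 expr0n => /eqP; rewrite eq_sym oner_eq0.
Qed.

Hypothesis km : (k <= m)%N.
Hypothesis V0 : (0 < #|V|)%N.

Let m0 : (0 < m)%N := leq_trans k0 km.
Let mR : 0 < m%:R :> R. Proof. by rewrite ltr0n. Qed.
Let kR : 0 < k%:R :> R. Proof. by rewrite ltr0n. Qed.

Lemma entry_flip (r : 'I_m) : exists2 g : V -> V, injective g &
  forall a, entry (g a) r = - entry a r /\
    forall s, s != r -> entry (g a) s = entry a s.
Proof.
have [|r' |g gI gE] := @entry_lift id (fun s => if s == r then -1 else 1).
- by [].
- by case: ifP; rewrite ?sqrrN expr1n.
exists g => // a; rewrite !gE eqxx mulN1r; split=> // s sr.
by rewrite gE (negPf sr) mul1r.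
Qed.

Lemma avg_entry_tperm (r s : 'I_m) (F : ('I_m -> R) -> R) :
  (forall x y, x =1 y -> F x = F y) ->
  avg (fun a : V => F (fun i => entry a (tperm r s i))) = avg (fun a : V => F (entry a)).
Proof.
move=> Fe; have [||g gI gE] := @entry_lift (tperm r s) (fun=> 1).
- exact: tpermK.
- by move=> ?; rewrite expr1n.
rewrite -[RHS](avg_reindex _ gI); apply: eq_avg => a; apply: Fe => i.
by rewrite gE mul1r.
Qed.

Lemma avg_entry2 r : avg (fun a : V => entry a r ^+ 2) = m%:R^-1.
Proof.
have E s : avg (fun a : V => entry a s ^+ 2) = avg (fun a : V => entry a r ^+ 2).
  rewrite -(avg_entry_tperm r s (F := fun x => x r ^+ 2)); last by move=> x y ->.
  by apply: eq_avg => a; rewrite tpermL.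
have : avg (fun a : V => \sum_s entry a s ^+ 2) = 1.
  rewrite -[RHS](avg_cst 1 V0); apply: eq_avg => a.
  exact: (entryP a).2.
rewrite avg_sum; under eq_bigr do rewrite E.
rewrite sumr_const card_ord => H.
by rewrite -[LHS](mulKf (negbT (gt_eqF mR))) mulr_natl H mulr1.
Qed.

Lemma avg_entryM r s : r != s -> avg (fun a : V => entry a r * entry a s) = 0.
Proof.
move=> rs; have [g gI gE] := entry_flip r; apply: (avg_odd gI) => a.
by have [-> ->] := gE a; rewrite 1?eq_sym// mulNr.
Qed.

Lemma entry4 a r : entry a r ^+ 4 = k%:R^-1 * entry a r ^+ 2.
Proof.
rewrite (exprM _ 2 2); have [->|->] := (entryP a).1 r; first by rewrite expr0n mulr0.
by rewrite expr2.
Qed.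

(** Transpositions that fix r show that the average is the same for all s <> r. The sum
over s is the average of x_r^2 (1 - x_r^2) = (1 - 1/k) x_r^2, that is
(1 - 1/k) / m, and [k <= m] bounds this by (m - 1) / m^2. *)
Lemma avg_entry22 r s : r != s ->
  avg (fun a : V => entry a r ^+ 2 * entry a s ^+ 2) <= m%:R^-1 ^+ 2.
Proof.
move=> rs.
have E t : t != r -> avg (fun a : V => entry a r ^+ 2 * entry a t ^+ 2) =
    avg (fun a : V => entry a r ^+ 2 * entry a s ^+ 2).
  move=> tr; rewrite -(avg_entry_tperm s t (F := fun x => x r ^+ 2 * x s ^+ 2)); last first.
    by move=> x y xy; rewrite !xy.
  by apply: eq_avg => a; rewrite tpermL tpermD// eq_sym.
have : \sum_(t | t != r) avg (fun a : V => entry a r ^+ 2 * entry a t ^+ 2) =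
    (1 - k%:R^-1) / m%:R.
  transitivity (avg (fun a : V => (1 - k%:R^-1) * entry a r ^+ 2)); last first.
    by rewrite avgZ avg_entry2.
  transitivity (avg (fun a : V => \sum_(t | t != r) entry a r ^+ 2 * entry a t ^+ 2)).
    rewrite [RHS]/avg exchange_big /= mulr_suml; by [].
  apply: eq_avg => a; rewrite -mulr_sumr.
  have := (entryP a).2; rewrite (bigD1 r)//= => H.
  rewrite (_ : \sum_(t | t != r) _ = 1 - entry a r ^+ 2); last by rewrite -H [RHS]addrC addKr.
  by rewrite mulrBr mulr1 -exprD entry4 mulrBl mul1r.
under eq_bigr => t tr do rewrite E//.
rewrite sumr_const => H.
have m1 : (1 < m)%N.
  case: m r s rs {E H} => [[//]|[|//]] r s; by rewrite !ord1.
have cE : #|[pred t | t != r]| = m.-1.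
  by have := cardC1 r; rewrite card_ord.
have m1R : 0 < m%:R - 1 :> R by rewrite subr_gt0 ltr1n.
have H' : (m%:R - 1) * avg (fun a : V => entry a r ^+ 2 * entry a s ^+ 2) =
    (1 - k%:R^-1) / m%:R.
  rewrite -H cE -[RHS]mulr_natl; congr (_ * _).
  by rewrite -[in LHS](prednK m0) -natr1 addrK.
rewrite -(ler_pM2l m1R) H'.
rewrite [leRHS](_ : _ = (1 - m%:R^-1) / m%:R); last by field; rewrite gt_eqF.
by rewrite ler_wpM2r ?invr_ge0// lerB// lef_pV2 ?posrE// ler_nat.
Qed.

(** Up to the factor 3 of [avg_pow4_sign_symmetric], the fourth moment against a
vector b is the average of (sum_r x_r^2 b_r^2)^2. The diagonal contributes
sum_r b_r^4 / (m k) = 1 / (m k^2), the rest at most 1 / m^2. *)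
Lemma isotropic_entry : isotropic entry (3 * ((m%:R * k%:R ^+ 2)^-1 + m%:R^-1 ^+ 2)).
Proof.
have unit a : dot (entry a) (entry a) = 1.
  by rewrite -[RHS](entryP a).2; apply: eq_bigr => r _; rewrite expr2.
split=> //.
- move=> x; under eq_avg => a do rewrite [dot _ _ ^+ 2]sqr_sum.
  rewrite avg_sum /dot mulr_suml; apply: eq_bigr => r _.
  rewrite avg_sum (bigD1 r)//= big1 ?addr0.
    under eq_avg => a.
      rewrite (_ : _ * _ = x r ^+ 2 * entry a r ^+ 2); last by ring.
      over.
    by rewrite avgZ avg_entry2 expr2.
  move=> s sr; under eq_avg => a.
    rewrite (_ : _ * _ = (x r * x s) * (entry a r * entry a s)); last by ring.
    over.
  by rewrite avgZ avg_entryM ?mulr0// eq_sym.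
- move=> b.
  apply: le_trans (avg_pow4_sign_symmetric (x := fun r a => entry a r * entry b r) _) _.
    have /choice[phi phiP] : forall r, exists g : V -> V, injective g /\
        forall a, entry (g a) r = - entry a r /\
          forall s, s != r -> entry (g a) s = entry a s.
      by move=> r; have [g gI gE] := entry_flip r; exists g.
    exists phi => r; have [gI gE] := phiP r; split=> // [a|s a sr].
      by rewrite (gE a).1 mulNr.
    by rewrite (gE a).2.
  rewrite ler_pM2l//; under eq_avg => a do rewrite sqr_sum.
  rewrite avg_sum.
  have b1 := (entryP b).2.
  apply: (@le_trans _ _ (\sum_r \sum_s
      (if s == r then (m%:R * k%:R ^+ 2)^-1 * entry b r ^+ 2 else 0) + \sum_r \sum_s (entry b r ^+ 2 * entry b s ^+ 2) * m%:R^-1 ^+ 2)).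
    rewrite -big_split; apply: ler_sum => r _; rewrite avg_sum -big_split.
    apply: ler_sum => s _ /=; case: eqVneq => [->|sr].
      under eq_avg => a.
        rewrite (_ : _ * _ = (entry b r ^+ 4 * k%:R^-1) * entry a r ^+ 2); last first.
          by rewrite -mulrA -entry4; ring.
        over.
      rewrite avgZ avg_entry2 entry4.
      apply: ler_wpDr.
        by apply: mulr_ge0; [apply: mulr_ge0|]; exact: sqr_ge0.
      rewrite le_eqVlt; apply/orP; left; apply/eqP; field.
      by rewrite !gt_eqF.
    under eq_avg => a.
      rewrite (_ : _ * _ = (entry b r ^+ 2 * entry b s ^+ 2) *
        (entry a r ^+ 2 * entry a s ^+ 2)); last by ring.
      over.
    rewrite avgZ add0r; apply: ler_wpM2l; first by apply: mulr_ge0; exact: sqr_ge0.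
    by apply: avg_entry22; rewrite eq_sym.
  rewrite lerD//.
    under eq_bigr do rewrite -big_mkcond big_pred1_eq.
    by rewrite -mulr_sumr b1 mulr1.
  under eq_bigr => r _ do rewrite -mulr_suml -mulr_sumr b1 mulr1.
  by rewrite -mulr_suml b1 mul1r.
- have [||g gI gE] := @entry_lift id (fun=> -1).
  + by [].
  + by move=> r; rewrite sqrrN expr1n.
  by exists g => // a r; rewrite gE mulN1r.
Qed.

End SparseSignVectors.

(** * Reduction to a finite uniform space *)

Section Transfer.
Context {R : realType} {d : measure_display} {T : measurableType d}.
Variables (P : probability T R) (m n k : nat) (S : T -> 'M[R]_(m, n)).
Hypothesis SP : sparse_sign_embedding P k S.
Hypothesis n0 : (0 < n)%N.
Local Notation A := (@sparse_sign_vectors R m k).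
Local Notation V := (@sparse_sign_fin R m k).

Lemma sparse_sign_finite : finite_set A.
Proof. by case: SP => _ _ /(_ (Ordinal n0))[]. Qed.

(** Otherwise the whole space would have probability 0/0, which is 0. *)
Lemma sparse_sign_card_gt0 : (0 < #|V|)%N.
Proof.
case: SP => _ _ /(_ (Ordinal n0))[_ /(_ setT)].
rewrite preimage_setT probability_setT setIT -cardfE lt0n => H.
have bT : borel (setT : set 'cV[R]_m) by apply: sub_sigma_algebra; exact: openT.
apply/eqP => c0; have := H bT.
by rewrite c0 mul0r => /eqP; rewrite eqe oner_eq0.
Qed.

Definition config_mx (c : {ffun 'I_n -> V}) : 'M[R]_(m, n) :=
  \matrix_(r, j) entry (c j) r.

Lemma col_config_mx c j : col j (config_mx c) = val (c j).
Proof. by apply/matrixP => r i; rewrite !mxE (ord1 i). Qed.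

Lemma borel_set1 (x : 'cV[R]_m) : borel [set x].
Proof.
rewrite -[X in borel X]setCK; apply: sigma_algebraC; apply: sub_sigma_algebra.
apply: closed_openC; apply: accessible_closed_set1; apply: hausdorff_accessible.
exact: norm_hausdorff.
Qed.

Let G (c : {ffun 'I_n -> V}) : set T := S @^-1` [set config_mx c].

Lemma config_event c :
  G c = \bigcap_(j in [set: 'I_n]) ((fun w => col j (S w)) @^-1` [set val (c j)]).
Proof.
apply/seteqP; split=> w /=.
  by move=> E j _ /=; rewrite E col_config_mx.
move=> H; apply/matrixP => r j.
have /= := H j I; rewrite -col_config_mx => /colP /(_ r).
by rewrite !mxE.
Qed.

Lemma measurable_config_event c : measurable (G c).
Proof.
rewrite config_event; apply: fin_bigcap_measurable => // j _.
by case: SP => Sm _ _; apply: Sm; exact: borel_set1.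
Qed.

(** Points are Borel sets, so that independence and uniformity of the columns apply to
singletons. *)
Lemma probability_config_event c :
  P (G c) = ((#|{ffun 'I_n -> V}|)%:R^-1)%:E.
Proof.
rewrite config_event; case: SP => _ Si Su.
rewrite (Si (fun j => [set val (c j)])); last by move=> j; exact: borel_set1.
have E j : P ((fun w => col j (S w)) @^-1` [set val (c j)]) = ((#|V|)%:R^-1)%:E.
  have [_ ->] := Su j; last exact: borel_set1.
  have Acj : A (val (c j)).
    by have := valP (c j); rewrite in_fset_set ?inE//; exact: sparse_sign_finite.
  rewrite (_ : A `&` [set val (c j)] = [set val (c j)]); last first.
    by apply/seteqP; split=> [x []//|x /= ->].
  by rewrite fset_set1 cardfs1 div1r -cardfE.
under eq_bigr do rewrite E.
rewrite card_ffun card_ord natrX -exprVn.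
elim: (n) => [|p IH]; first by rewrite big_ord0 expr0.
by rewrite big_ord_recr /= IH -EFinM exprSr.
Qed.

(** The events S = M for the admissible matrices M are disjoint, equally likely and of
total probability 1. Measurability of the event is needed to discard its part
outside their union. *)
Lemma probability_embedding (E : set 'M[R]_(m, n)) : measurable (S @^-1` E) ->
  P (S @^-1` E) = (avg (fun c => (config_mx c \in E)%:R : R))%:E.
Proof.
move=> mE.
have mG := measurable_config_event.
have N0 : (#|{ffun 'I_n -> V}|)%:R != 0 :> R.
  by rewrite pnatr_eq0 -lt0n card_config_gt0// sparse_sign_card_gt0.
have inj c c' : config_mx c = config_mx c' -> c = c'.
  by move=> cc; apply/ffunP => j; apply/val_inj; rewrite -!col_config_mx cc.
have sum_event (F : set T) : measurable F ->
    P (\bigcup_(c in [set: {ffun 'I_n -> V}]) (G c `&` F)) = (\sum_c P (G c `&` F))%E.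
  move=> mF; rewrite measure_fin_bigcup.
  - rewrite (fsbigE (index_enum _)) ?index_enum_uniq//; last first.
      by move=> c _; rewrite mem_index_enum.
    by apply: eq_bigl => c; rewrite in_setT.
  - exact: finite_finset.
  - by move=> c c' _ _ [w [[/= wc _] [/= wc' _]]]; apply: inj; rewrite -wc.
  - by move=> c _; exact: measurableI.
pose U := \bigcup_(c in [set: {ffun 'I_n -> V}]) (G c).
have mU : measurable U by apply: fin_bigcup_measurable => // c _; exact: mG.
have P1 : P U = 1%E.
  have := sum_event setT measurableT.
  under eq_bigcupr do rewrite setIT.
  under eq_bigr do rewrite setIT probability_config_event.
  by rewrite sumEFin sumr_const -[_^-1 *+ _]mulr_natr mulVf.
have PU0 : P (~` U) = 0%E by rewrite probability_setC// P1 subee.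
have -> : P (S @^-1` E) = P (\bigcup_(c in [set: {ffun 'I_n -> V}]) (G c `&` S @^-1` E)).
  rewrite -setI_bigcupl -/U setIC.
  rewrite -[in LHS](setIT (S @^-1` E)) -(setUv U) setIUr measureU.
  - rewrite [X in (_ + X)%E](_ : _ = 0%E) ?adde0//.
    apply: (subset_measure0 _ _ _ PU0) => //.
    + by apply: measurableI => //; exact: measurableC.
    + exact: measurableC.
  - exact: measurableI.
  - by apply: measurableI => //; exact: measurableC.
  - by rewrite setIACA setICr setI0.
rewrite sum_event//.
have E1 c : P (G c `&` S @^-1` E) =
    ((config_mx c \in E)%:R / (#|{ffun 'I_n -> V}|)%:R)%:E.
  have [cE|cE] := boolP (config_mx c \in E).
    rewrite (_ : _ `&` _ = G c) ?probability_config_event ?div1r//.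
    apply/seteqP; split=> [w []//|w Gw]; split=> //.
    by rewrite /preimage /= Gw; move: cE; rewrite inE.
  rewrite (_ : _ `&` _ = set0) ?measure0 ?mul0r//.
  apply/seteqP; split=> // w [/= -> Ec].
  by move: cE; rewrite notin_setE.
under eq_bigr do rewrite E1.
by rewrite sumEFin -mulr_suml.
Qed.

Lemma measurable_entry r j : measurable_fun setT (fun w => S w r j).
Proof.
apply: (measurability _ (RGenOpens.measurableE R)).
move=> _ [_ [a [b ->] <-]]; rewrite setTI.
case: SP => Sm _ _.
pose B : set 'cV[R]_m := (fun x : 'cV[R]_m => x r 0) @^-1` `]a, b[.
have : borel B.
  apply: sub_sigma_algebra; apply: open_comp; last exact: interval_open.
  by move=> x _; exact: coord_continuous.
move=> /(Sm j); rewrite (_ : _ @^-1` B = (fun w => S w r j) @^-1` `]a, b[)//.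
by apply/seteqP; split=> w /=; rewrite /B /= mxE.
Qed.

End Transfer.

(** * The coefficients of the centred bilinear form *)

Section Coefficients.
Context {R : realType} {n : nat}.
Variables (a b : 'I_n -> R) (M s : R).
Hypotheses (a1 : \sum_i a i ^+ 2 = 1) (b1 : \sum_i b i ^+ 2 = 1).
Let rho := \sum_i a i * b i.
Hypotheses (M0 : 0 < M) (sE : s ^+ 2 = M / (1 + rho ^+ 2)).

(** The factor 1/2 in [quad] compensates for the symmetrization. *)
Definition coef (j k : 'I_n) : R :=
  if j == k then 0 else s * (a j * b k + a k * b j).

Lemma coef_hollow_sym : hollow_sym coef.
Proof.
split=> [j k|k]; last by rewrite /coef eqxx.
by rewrite /coef eq_sym; case: eqP => // _; rewrite addrC.
Qed.

Let rho1 : 1 <= 1 + rho ^+ 2. Proof. by rewrite lerDl sqr_ge0. Qed.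

Let r0 : 0 < 1 + rho ^+ 2. Proof. exact: lt_le_trans ltr01 rho1. Qed.

Let sM : s ^+ 2 <= M.
Proof. by rewrite sE ler_pdivrMr ?(lt_le_trans ltr01)// ler_peMr// ltW. Qed.

Lemma sum_coef_pow4 : \sum_k \sum_j coef j k ^+ 4 <=
  16 * M ^+ 2 * ((\sum_i a i ^+ 4) * (\sum_i b i ^+ 4)).
Proof.
have s4 : 0 <= s ^+ 4 <= M ^+ 2.
  rewrite exprn_even_ge0//= (exprM s 2 2) ler_sqr ?nnegrE ?sqr_ge0//.
  exact: ltW.
have E : 16 * M ^+ 2 * ((\sum_i a i ^+ 4) * (\sum_i b i ^+ 4)) =
  \sum_k \sum_j (8 * M ^+ 2) * (a j ^+ 4 * b k ^+ 4 + a k ^+ 4 * b j ^+ 4).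
  under [RHS]eq_bigr do rewrite -mulr_sumr big_split /= -mulr_suml -mulr_sumr.
  by rewrite -mulr_sumr big_split /= -mulr_suml -mulr_sumr; ring.
rewrite E; apply: ler_sum => k _; apply: ler_sum => j _.
rewrite /coef; case: eqP => _.
  rewrite expr0n; apply: mulr_ge0; first by apply: mulr_ge0 => //; exact: sqr_ge0.
  by apply: addr_ge0; apply: mulr_ge0; rewrite exprn_even_ge0.
rewrite -!exprMn; set x := a j * b k; set y := a k * b j; rewrite exprMn.
have xy : (x + y) ^+ 4 <= 8 * (x ^+ 4 + y ^+ 4).
  have h1 : (x + y) ^+ 2 <= 2 * (x ^+ 2 + y ^+ 2) by have := sqr_ge0 (x - y); lra.
  have h2 : ((x + y) ^+ 2) ^+ 2 <= (2 * (x ^+ 2 + y ^+ 2)) ^+ 2.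
    by rewrite ler_sqr ?nnegrE ?sqr_ge0// mulr_ge0// addr_ge0 ?sqr_ge0.
  by have := sqr_ge0 (x ^+ 2 - y ^+ 2); lra.
case/andP: s4 => s40 s4M.
have p4 : 0 <= (x + y) ^+ 4 by rewrite exprn_even_ge0.
rewrite [leRHS](_ : _ = M ^+ 2 * (8 * (x ^+ 4 + y ^+ 4))); last by ring.
exact: ler_pM.
Qed.

Lemma sum_coef_row k : \sum_j coef j k ^+ 2 <= 2 * M * (a k ^+ 2 + b k ^+ 2).
Proof.
have E : 2 * M * (a k ^+ 2 + b k ^+ 2) =
    \sum_j 2 * M * (a j ^+ 2 * b k ^+ 2 + a k ^+ 2 * b j ^+ 2).
  rewrite -mulr_sumr big_split /= -mulr_suml -mulr_sumr a1 b1; ring.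
rewrite E; apply: ler_sum => j _; rewrite /coef; case: eqP => _.
  rewrite expr0n; apply: mulr_ge0; first by apply: mulr_ge0 => //; exact: ltW.
  by apply: addr_ge0; apply: mulr_ge0; exact: sqr_ge0.
rewrite -!exprMn; set x := a j * b k; set y := a k * b j; rewrite exprMn.
rewrite [leRHS](_ : _ = M * (2 * (x ^+ 2 + y ^+ 2))); last by ring.
apply: ler_pM => //; rewrite ?sqr_ge0//.
by have := sqr_ge0 (x - y); lra.
Qed.

Lemma sum_coef_row2 : \sum_k (\sum_j coef j k ^+ 2 / M) ^+ 2 <=
  8 * (\sum_i a i ^+ 4 + \sum_i b i ^+ 4).
Proof.
rewrite -big_split mulr_sumr /=; apply: ler_sum => k _.
have h : \sum_j coef j k ^+ 2 / M <= 2 * (a k ^+ 2 + b k ^+ 2).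
  rewrite -mulr_suml ler_pdivrMr// (le_trans (sum_coef_row k))//.
  by rewrite le_eqVlt; apply/orP; left; apply/eqP; ring.
apply: (@le_trans _ _ ((2 * (a k ^+ 2 + b k ^+ 2)) ^+ 2)).
  rewrite ler_sqr ?nnegrE ?mulr_ge0 ?addr_ge0 ?sqr_ge0//.
  by apply: sumr_ge0 => j _; rewrite divr_ge0 ?sqr_ge0 ?(ltW M0).
by have := sqr_ge0 (a k ^+ 2 - b k ^+ 2); lra.
Qed.

(** Without the condition j <> k the value would be exactly 1; the defect is the
contribution of the diagonal. *)
Lemma sum_coef2 : 2^-1 * \sum_k \sum_j coef j k ^+ 2 / M =
  1 - 2 * (\sum_i a i ^+ 2 * b i ^+ 2) / (1 + rho ^+ 2).
Proof.
have E k : \sum_j coef j k ^+ 2 / M = (1 + rho ^+ 2)^-1 *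
    (b k ^+ 2 + a k ^+ 2 + 2 * rho * (a k * b k) - 4 * (a k ^+ 2 * b k ^+ 2)).
  have -> : \sum_j coef j k ^+ 2 / M = (1 + rho ^+ 2)^-1 *
      \sum_(j | j != k) (a j * b k + a k * b j) ^+ 2.
    rewrite mulr_sumr [RHS]big_mkcond; apply: eq_bigr => j _ /=.
    rewrite /coef; case: eqP => _ /=; first by rewrite expr0n mul0r.
    rewrite exprMn sE; field; by rewrite !gt_eqF.
  congr (_ * _).
  have : \sum_j (a j * b k + a k * b j) ^+ 2 =
      b k ^+ 2 + a k ^+ 2 + 2 * rho * (a k * b k).
    transitivity (\sum_j (a j ^+ 2 * b k ^+ 2 + a k ^+ 2 * b j ^+ 2 +
        a j * b j * (2 * (a k * b k)))).
      by apply: eq_bigr => j _; ring.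
    by rewrite !big_split /= -!mulr_suml -mulr_sumr a1 b1 -/rho; ring.
  by rewrite (bigD1 k)//= => <-; ring.
under eq_bigr do rewrite E.
rewrite -mulr_sumr sumrB !big_split /= -!mulr_sumr a1 b1 -/rho.
by field; rewrite gt_eqF.
Qed.

Let q_bound : 0 <= 2 * (\sum_i a i ^+ 2 * b i ^+ 2) / (1 + rho ^+ 2) <=
  \sum_i a i ^+ 4 + \sum_i b i ^+ 4.
Proof.
have q0 : 0 <= \sum_i a i ^+ 2 * b i ^+ 2.
  by apply: sumr_ge0 => i _; rewrite mulr_ge0 ?sqr_ge0.
rewrite divr_ge0 ?mulr_ge0 ?(ltW r0)//= ler_pdivrMr//.
apply: (@le_trans _ _ (\sum_i a i ^+ 4 + \sum_i b i ^+ 4)).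
  rewrite mulr_sumr -big_split /=; apply: ler_sum => i _.
  by have := sqr_ge0 (a i ^+ 2 - b i ^+ 2); lra.
by rewrite ler_peMr// addr_ge0// sumr_ge0// => i _; rewrite exprn_even_ge0.
Qed.

Lemma coef_qvar_le1 : 2^-1 * \sum_k \sum_j coef j k ^+ 2 / M <= 1.
Proof. by rewrite sum_coef2; case/andP: q_bound; lra. Qed.

Lemma coef_qvar_near1 : `|2^-1 * (\sum_k \sum_j coef j k ^+ 2 / M) - 1| <=
  \sum_i a i ^+ 4 + \sum_i b i ^+ 4.
Proof.
rewrite sum_coef2 distrC opprB addrC subrK; case/andP: q_bound => q0 ?.
by rewrite ger0_norm.
Qed.

End Coefficients.

(** * The Stein bound for a sparse sign embedding *)

Section EmbeddingBounds.
Context {R : realType} {V : finType} {m n k : nat}.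
Variables (v : V -> 'I_m -> R) (a b : 'I_n -> R) (s : R).
Hypotheses (m0 : (0 < m)%N) (k0 : (0 < k)%N).
Hypothesis vP : isotropic v (3 * ((m%:R * k%:R ^+ 2)^-1 + m%:R^-1 ^+ 2)).
Hypotheses (a1 : \sum_i a i ^+ 2 = 1) (b1 : \sum_i b i ^+ 2 = 1).
Hypothesis sE : s ^+ 2 = m%:R / (1 + (\sum_i a i * b i) ^+ 2).
Local Notation c := (coef a b s).
Local Notation alpha := (\sum_i a i ^+ 4).
Local Notation beta := (\sum_i b i ^+ 4).

Let M0 : 0 < m%:R :> R. Proof. by rewrite ltr0n. Qed.
Let K0 : 0 < k%:R :> R. Proof. by rewrite ltr0n. Qed.
Let alpha0 : 0 <= alpha. Proof. by apply: sumr_ge0 => i _; rewrite exprn_even_ge0. Qed.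
Let beta0 : 0 <= beta. Proof. by apply: sumr_ge0 => i _; rewrite exprn_even_ge0. Qed.

Lemma sum_avg_incr4 : \sum_j avg (fun w => incr v c j w ^+ 4) <=
  144 * (m%:R / k%:R ^+ 2 + 1) * (alpha * beta) + 24 * (alpha + beta).
Proof.
pose kappa : R := 3 * ((m%:R * k%:R ^+ 2)^-1 + m%:R^-1 ^+ 2).
have kappa0 : 0 <= kappa.
  by apply: mulr_ge0 => //; rewrite addr_ge0 ?sqr_ge0// invr_ge0 mulr_ge0 ?sqr_ge0.
apply: (@le_trans _ _ (3 * (kappa * \sum_j \sum_i c i j ^+ 4 +
    \sum_j (\sum_i c i j ^+ 2 / m%:R) ^+ 2))).
  rewrite mulr_sumr -big_split mulr_sumr; apply: ler_sum => j _ /=.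
  rewrite -mulr_suml. exact: (avg_incr4 vP j (coef_hollow_sym a b s)).
have h1 := ler_wpM2l kappa0 (sum_coef_pow4 M0 sE).
have h2 := sum_coef_row2 a1 b1 M0 sE.
have -> : 144 * (m%:R / k%:R ^+ 2 + 1) * (alpha * beta) + 24 * (alpha + beta) =
    3 * (kappa * (16 * m%:R ^+ 2 * (alpha * beta)) + 8 * (alpha + beta)).
  by rewrite /kappa; field; rewrite !gt_eqF.
by rewrite ler_pM2l// lerD.
Qed.

Variables (f f1 : R -> R) (L B eta : R).
Hypotheses (L0 : 0 <= L) (B0 : 0 <= B) (eta0 : 0 < eta).
Hypothesis taylor : forall x y, `|f y - f x - f1 x * (y - x)| <= L * (y - x) ^+ 2.
Hypothesis lip : forall x y, `|f1 y - f1 x| <= L * `|y - x|.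
Hypothesis bnd : forall x, `|f1 x| <= B.
Hypothesis km : k%:R ^+ 2 / m%:R <= 1 :> R.
Let t := Num.sqrt m%:R / k%:R * alpha.
Let u := Num.sqrt m%:R / k%:R * beta.

(** The assumption [km] says that sqrt m / k >= 1, so that [alpha <= t] and
[beta <= u]. The leading fourth moment term m / k^2 * alpha * beta is [t * u]. *)
Lemma stein_bound_embedding :
  `|avg (fun w => f1 (quad v c w) - quad v c w * f (quad v c w))| <=
  eta * (2 * L + B) + (4 * eta)^-1 * (L * (288 * (t * u) + 24 * (t + u)) +
    B * (4 * (k%:R ^+ 2 / m%:R) + 2 * (t + u) ^+ 2)).
Proof.
have sq : Num.sqrt m%:R ^+ 2 = m%:R :> R by rewrite sqr_sqrtr// ltW.
have sk : 1 <= Num.sqrt m%:R / k%:R :> R.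
  rewrite ler_pdivlMr// mul1r -ler_sqr ?nnegrE ?sqrtr_ge0 ?(ltW K0)// sq.
  by move: km; rewrite ler_pdivrMr// mul1r.
have at_ : alpha <= t by rewrite ler_peMl.
have bu : beta <= u by rewrite ler_peMl.
have tu : m%:R / k%:R ^+ 2 * (alpha * beta) = t * u.
  transitivity (Num.sqrt m%:R ^+ 2 / k%:R ^+ 2 * (alpha * beta)); first by rewrite sq.
  by rewrite /t /u; field; rewrite gt_eqF.
have hq : qvar (m := m) c <= 1 := coef_qvar_le1 a1 b1 M0 sE.
have hq1 : `|qvar (m := m) c - 1| <= t + u.
  exact: le_trans (coef_qvar_near1 a1 b1 M0 sE) (lerD at_ bu).
have hq0 : 0 <= qvar (m := m) c.
  apply: mulr_ge0 => //; apply: sumr_ge0 => i _; apply: sumr_ge0 => j _.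
  by rewrite divr_ge0 ?sqr_ge0 ?(ltW M0).
apply: le_trans (stein_bound_quad vP (coef_hollow_sym a b s) L0 B0 taylor lip bnd eta0) _.
apply: lerD.
  by rewrite ler_pM2l// lerD2r ler_piMr ?mulr_ge0.
rewrite ler_wpM2l ?invr_ge0 ?mulr_ge0 ?(ltW eta0)//.
apply: lerD; apply: ler_wpM2l => //.
  apply: le_trans sum_avg_incr4 _.
  have ab : alpha * beta <= t * u by apply: ler_pM.
  have E : (m%:R / k%:R ^+ 2 + 1) * (alpha * beta) = t * u + alpha * beta.
    by rewrite mulrDl mul1r tu.
  by rewrite -(mulrA 144) E; lra.
apply: lerD.
  rewrite -mulrA ler_pM2l// ler_wpM2r ?invr_ge0 ?(ltW M0)//.
  rewrite (@le_trans _ _ 1)// ?expr_le1//.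
  by rewrite -natrX ler1n expn_gt0 k0.
rewrite ler_pM2l// -real_normK ?num_real// ler_sqr ?nnegrE//.
by rewrite addr_ge0// (le_trans _ at_, le_trans _ bu).
Qed.

Lemma avg_quad2_le1 : avg (fun w => quad v c w ^+ 2) <= 1.
Proof.
rewrite (avg_quad2 vP (coef_hollow_sym a b s)).
exact: coef_qvar_le1 a1 b1 M0 sE.
Qed.

End EmbeddingBounds.

Lemma embedding_quad (R : realType) (m n k : nat) (x y : 'cV[R]_n) (s : R)
    (c : {ffun 'I_n -> @sparse_sign_fin R m k}) :
  (0 < k)%N -> finite_set (@sparse_sign_vectors R m k) ->
  s * ((x^T *m (config_mx c)^T *m config_mx c *m y) 0 0 - dotp x y) =
  quad (@entry R m k) (coef (fun i => x i 0) (fun i => y i 0) s) c.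
Proof.
move=> k0 finA.
have unit j : gram (@entry R m k) c j j = 1.
  by rewrite -[RHS](entryP k0 finA (c j)).2; apply: eq_bigr => r _; rewrite expr2.
have E : (x^T *m (config_mx c)^T *m config_mx c *m y) 0 0 =
    \sum_i \sum_j x i 0 * y j 0 * gram (@entry R m k) c i j.
  rewrite -mulmxA -trmx_mul mxE.
  under eq_bigr => r _.
    rewrite !mxE mulr_suml.
    under eq_bigr => i _ do rewrite mulr_sumr.
    over.
  rewrite /= exchange_big /=; apply: eq_bigr => i _.
  rewrite exchange_big /=; apply: eq_bigr => j _.
  rewrite /gram /dot mulr_sumr; apply: eq_bigr => r _.
  by rewrite !mxE; ring.
rewrite E dotpE /quad.
pose w i j := x i 0 * y j 0 * gram (@entry R m k) c i j.
have D : \sum_i \sum_j w i j - \sum_i x i 0 * y i 0 = \sum_i \sum_(j | j != i) w i j.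
  rewrite -sumrB; apply: eq_bigr => i _; rewrite (bigD1 i)//= /w unit mulr1.
  by rewrite addrC addrK.
rewrite -/w D.
have -> : \sum_j \sum_l coef (fun i => x i 0) (fun i => y i 0) s j l * gram (@entry R m k) c j l =
    s * (\sum_i \sum_(j | j != i) w i j + \sum_i \sum_(j | j != i) w j i).
  rewrite -big_split mulr_sumr /=; apply: eq_bigr => i _.
  rewrite -big_split mulr_sumr [RHS]big_mkcond /=; apply: eq_bigr => j _.
  rewrite /coef eq_sym; case: eqP => _ /=; first by rewrite mul0r.
  by rewrite /w (gramC _ c j i); ring.
have -> : \sum_i \sum_(j | j != i) w j i = \sum_i \sum_(j | j != i) w i j.
  rewrite (exchange_big_dep xpredT)//=; apply: eq_bigr => i _.
  by apply: eq_bigl => j; rewrite eq_sym.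
by field.
Qed.

Lemma probability_quad_embedding (R : realType) (d : measure_display)
    (T : measurableType d) (P : probability T R) (m n k : nat)
    (S : T -> 'M[R]_(m, n)) (x y : 'cV[R]_n) (s z : R) :
  (0 < n)%N -> (0 < k)%N -> sparse_sign_embedding P k S ->
  P [set w | s * ((x^T *m (S w)^T *m S w *m y) 0 0 - dotp x y) <= z] =
  (avg (fun c : {ffun 'I_n -> @sparse_sign_fin R m k} =>
     (quad (@entry R m k) (coef (fun i => x i 0) (fun i => y i 0) s) c <= z)%R%:R))%:E.
Proof.
move=> n0 k0 SP.
pose g (M : 'M[R]_(m, n)) := s * ((x^T *m M^T *m M *m y) 0 0 - dotp x y).
have mg : measurable_fun setT (g \o S).
  rewrite (_ : g \o S = fun w => s * (\sum_(r < m)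
      (\sum_(i < n) x i 0 * S w r i) * (\sum_(j < n) S w r j * y j 0) - dotp x y)).
    apply: measurable_funM => //; apply: measurable_funB => //.
    apply: measurable_sum => r; apply: measurable_funM;
      apply: measurable_sum => i; apply: measurable_funM => //;
      exact: (measurable_entry SP).
  apply/funext => w; rewrite /g /=; congr (_ * (_ - _)).
  rewrite -mulmxA -trmx_mul mxE; apply: eq_bigr => r _; rewrite !mxE.
  by congr (_ * _); apply: eq_bigr => i _; rewrite mulrC.
have -> : [set w | s * ((x^T *m (S w)^T *m S w *m y) 0 0 - dotp x y) <= z] =
    S @^-1` [set M | g M <= z] by [].
have mE : measurable (S @^-1` [set M | g M <= z]).
  rewrite (_ : _ @^-1` _ = setT `&` (g \o S) @^-1` `]-oo, z]).
    by apply: mg => //; exact: measurable_itv.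
  by rewrite setTI; apply/seteqP; split=> w /=; rewrite in_itv.
rewrite (probability_embedding SP n0 mE); congr (_%:E); apply: eq_avg => c.
rewrite -(embedding_quad x y s c k0 (sparse_sign_finite SP n0)).
by congr (nat_of_bool _)%:R; apply/idP/idP; rewrite inE.
Qed.

(** * Convergence to the normal law *)

Theorem mainTheorem11 (R : realType) (m zeta : nat -> nat)
    (d : nat -> measure_display) (T : forall n, measurableType (d n))
    (P : forall n, probability (T n) R)
    (S : forall n, T n -> 'M[R]_(m n, n))
    (a a' : forall n, 'cV[R]_n)
    (hmn : \forall n \near \oo, (m n < n)%N)
    (hm : m n @[n --> \oo] --> \oo)
    (hzeta : forall k, (0 < k)%N -> (1 <= zeta k <= k)%N)
    (hS : forall n, (0 < m n)%N -> sparse_sign_embedding (P n) (zeta (m n)) (@S n))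
    (ha : forall n, (0 < n)%N -> dotp (a n) (a n) = 1)
    (ha' : forall n, (0 < n)%N -> dotp (a' n) (a' n) = 1)
    (hsparse : (zeta (m n))%:R ^+ 2 / (m n)%:R @[n --> \oo] --> (0 : R))
    (hdeloc : Num.sqrt (m n)%:R / (zeta (m n))%:R * \sum_(i < n) a n i 0 ^+ 4
                @[n --> \oo] --> (0 : R))
    (hdeloc' : Num.sqrt (m n)%:R / (zeta (m n))%:R * \sum_(i < n) a' n i 0 ^+ 4
                @[n --> \oo] --> (0 : R)) :
  cvg_in_distribution P
    (fun n w =>
       Num.sqrt ((m n)%:R / (1 + dotp (a n) (a' n) ^+ 2)) *
       (((a n)^T *m (S n w)^T *m S n w *m a' n) 0 0 - dotp (a n) (a' n)))
    (normal_prob 0 1).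
Proof.
pose k n := zeta (m n).
pose s n : R := Num.sqrt ((m n)%:R / (1 + dotp (a n) (a' n) ^+ 2)).
pose I n : finType := {ffun 'I_n -> @sparse_sign_fin R (m n) (k n)}.
pose X n (c : I n) : R := quad (@entry R (m n) (k n))
  (coef (fun i => a n i 0) (fun i => a' n i 0) (s n)) c.
have n_gt0 : \forall n \near \oo, (0 < n)%N by exact: nbhs_infty_gt.
have m_gt0 : \forall n \near \oo, (0 < m n)%N by exact: (hm _ (nbhs_infty_gt 0)).
have km_le1 : \forall n \near \oo, (k n)%:R ^+ 2 / (m n)%:R <= 1 :> R.
  by move/cvgrPdist_le : hsparse => /(_ 1 ltr01); apply: filterS => n /=;
     rewrite sub0r normrN; apply: le_trans; exact: ler_norm.
have k_gt0 n : (0 < m n)%N -> (0 < k n)%N by move=> /hzeta /andP[].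
have unit (x : forall n, 'cV[R]_n) n : (forall n, (0 < n)%N -> dotp (x n) (x n) = 1) ->
    (0 < n)%N -> \sum_(i < n) x n i 0 ^+ 2 = 1.
  by move=> hx n0; rewrite -(hx _ n0) dotpE; apply: eq_bigr => i _; rewrite expr2.
have sE n : s n ^+ 2 = (m n)%:R / (1 + (\sum_(i < n) a n i 0 * a' n i 0) ^+ 2).
  by rewrite /s sqr_sqrtr dotpE// divr_ge0// addr_ge0// sqr_ge0.
have iso n (n0 : (0 < n)%N) (m0 : (0 < m n)%N) := isotropic_entry (k_gt0 _ m0)
  (sparse_sign_finite (hS _ m0) n0) (proj2 (andP (hzeta _ m0)))
  (sparse_sign_card_gt0 (hS _ m0) n0).
have I0 : \forall n \near \oo, (0 < #|I n|)%N.
  near=> n; have n0 : (0 < n)%N by near: n.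
  have m0 : (0 < m n)%N by near: n.
  by apply: card_config_gt0; exact: (sparse_sign_card_gt0 (hS n m0) n0).
have X2 : \forall n \near \oo, avg (fun c : I n => X n c ^+ 2) <= 1.
  near=> n; have n0 : (0 < n)%N by near: n.
  have m0 : (0 < m n)%N by near: n.
  exact: (avg_quad2_le1 m0 (iso n n0 m0) (unit _ _ ha n0) (unit _ _ ha' n0) (sE n)).
have stein (f f1 : R -> R) (L B : R) : 0 <= L -> 0 <= B ->
    (forall x y, `|f y - f x - f1 x * (y - x)| <= L * (y - x) ^+ 2) ->
    (forall x y, `|f1 y - f1 x| <= L * `|y - x|) ->
    (forall x, `|f1 x| <= B) ->
    avg (fun c : I n => f1 (X n c) - X n c * f (X n c)) @[n --> \oo] --> 0.
  move=> L0 B0 taylor lip bnd; apply/cvgrPdist_le => e e0.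
  have den0 : 0 < 2 * (2 * L + B + 1) by rewrite mulr_gt0// ltr_wpDl// addr_ge0// mulr_ge0.
  (* With this choice the part of the Stein bound that persists as n grows is at
     most e / 2. *)
  pose eta := e / (2 * (2 * L + B + 1)).
  have eta0 : 0 < eta by rewrite divr_gt0.
  have small : eta * (2 * L + B) <= e / 2.
    rewrite /eta mulrAC ler_pdivrMr//.
    have -> : e / 2 * (2 * (2 * L + B + 1)) = e * (2 * L + B + 1) by field.
    by rewrite ler_pM2l// lerDl.
  pose t n : R := Num.sqrt (m n)%:R / (k n)%:R * \sum_(i < n) a n i 0 ^+ 4.
  pose u n : R := Num.sqrt (m n)%:R / (k n)%:R * \sum_(i < n) a' n i 0 ^+ 4.
  pose r n : R := (4 * eta)^-1 * (L * (288 * (t n * u n) + 24 * (t n + u n)) +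
    B * (4 * ((k n)%:R ^+ 2 / (m n)%:R) + 2 * (t n + u n) ^+ 2)).
  have r_cvg : r n @[n --> \oo] --> (0 : R).
    have tu : t n + u n @[n --> \oo] --> (0 : R) + 0 by exact: cvgD.
    have -> : (0 : R) = (4 * eta)^-1 * (L * (288 * (0 * 0) + 24 * (0 + 0)) +
      B * (4 * 0 + 2 * ((0 + 0) * (0 + 0)))) by ring.
    apply: cvgMr; apply: cvgD; apply: cvgMr; apply: cvgD; apply: cvgMr => //.
    - exact: cvgM.
    - exact: cvgM.
  have r_small : \forall n \near \oo, `|0 - r n| <= e / 2.
    by move/cvgrPdist_le : r_cvg; apply; rewrite divr_gt0.
  near=> n; have n0 : (0 < n)%N by near: n.
  have m0 : (0 < m n)%N by near: n.
  have km : (k n)%:R ^+ 2 / (m n)%:R <= 1 :> R by near: n.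
  have rn : `|0 - r n| <= e / 2 by near: n.
  rewrite sub0r normrN.
  apply: le_trans (stein_bound_embedding m0 (k_gt0 _ m0) (iso n n0 m0)
    (unit _ _ ha n0) (unit _ _ ha' n0) (sE n) L0 B0 eta0 taylor lip bnd km) _.
  rewrite [leRHS](splitr e) lerD// (le_trans _ rn)// sub0r normrN.
  exact: ler_norm.
move=> z _; rewrite normal_prob_cdf.
have cdf : avg (fun c : I n => (X n c <= z)%R%:R : R) @[n --> \oo] --> gauss_cdf z.
  exact (stein_criterion I0 X2 stein (x := z)).
have : (avg (fun c : I n => (X n c <= z)%R%:R))%:E @[n --> \oo] --> (gauss_cdf z)%:E.
  by apply: cvg_EFin => //; exact: nearW.
apply: cvg_trans; apply: near_eq_cvg; near=> n.
have m0 : (0 < m n)%N by near: n.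
apply/esym; apply: probability_quad_embedding; first by near: n.
  exact: k_gt0.
exact: hS.
Unshelve. all: by end_near. Qed.
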